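(* Let $\Omega\subset\mathbb C^n$ be open and let $\Phi:\Omega\to\mathbb R$ be real-analytic and strictly plurisubharmonic. Assume that two linear operators $\Pi_0$ and $\tilde\Pi$ on $L^2_{\Phi,\mathrm{loc}}(\Omega)$ each satisfy the following properties (stated for $\Pi_0$): (P1) $\Pi_0$ is uniformly continuous $L^2_{\Phi,\mathrm{loc}}(\Omega)\to H^{\mathrm{loc}}_{\Phi,\Phi_1}(\Omega)$ for some $\Phi_1\in C^0(\Omega;\mathbb R)$ with $\Phi_1<\Phi$; (P2) $\Pi_0$ is uniformly properly supported; (P3) $\Pi_0\equiv_\Phi\Pi_0^*$; (P4) if $\Phi_1\in C^0(\Omega;\mathbb R)$ satisfies $\Phi_1<\Phi$, then there exists $\Phi_2\in C^0(\Omega;\mathbb R)$ with $\Phi_2<\Phi$ such that $\Pi_0-1=\mathcal O(1):H^{\mathrm{loc}}_{\Phi,\Phi_1}(\Omega)\to L^2_{\Phi_2,\mathrm{loc}}(\Omega)$. Then $\tilde\Pi\equiv_\Phi\Pi_0$.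
   Context: $0<\hbar\le1$ is a semiclassical parameter; functions and operators may depend on $\hbar$; constants are independent of $\hbar$. $\tilde\Omega\Subset\Omega$ means that the closure of $\tilde\Omega$ is a compact subset of $\Omega$; $L(\mathrm dx)$ is Lebesgue measure. For $\Phi\in C^0(\Omega;\mathbb R)$: $L^2_\Phi(\Omega)=L^2(\Omega;e^{-2\Phi/\hbar}L(\mathrm dx))$; $L^2_{\Phi,\mathrm{loc}}(\Omega)$ is $L^2_{\mathrm{loc}}(\Omega)$ with the seminorms $\|u\|_{L^2_\Phi(\tilde\Omega)}$, $\tilde\Omega\Subset\Omega$. For $\Phi_1\in C^0(\Omega;\mathbb R)$, $H^{\mathrm{loc}}_{\Phi,\Phi_1}(\Omega)=\{u\in L^2_{\Phi,\mathrm{loc}}(\Omega):\hbar\bar\partial u\in L^2_{\Phi_1,\mathrm{loc}}(\Omega)\}$ with the seminorms $\|u\|_{L^2_\Phi(\tilde\Omega)}+\|\hbar\bar\partial u\|_{L^2_{\Phi_1}(\tilde\Omega)}$. A linear operator $A=A_\hbar$ between two such spaces is uniformly continuous, written $A=\mathcal O(1)$, if there is $\hbar_0>0$ such that for every $\tilde\Omega_2\Subset\Omega$ there exist $\tilde\Omega_1\Subset\Omega$ and $C>0$, independent of $\hbar$, such that for all $\hbar\in]0,\hbar_0]$ and all $u$ the seminorm of $Au$ over $\tilde\Omega_2$ is at most $C$ times the seminorm of $u$ over $\tilde\Omega_1$. $A$ with distribution kernel $K_A$ is uniformly properly supported if there is $\hbar_0>0$ such that for every $\tilde\Omega_2\Subset\Omega$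 there is an $\hbar$-independent $\tilde\Omega_1\Subset\Omega$ with $\{y:\exists x\in\tilde\Omega_2,\ (x,y)\in\operatorname{supp}K_A\}\subset\tilde\Omega_1$ for all $\hbar\in]0,\hbar_0]$, and for every $\tilde\Omega_1\Subset\Omega$ there is an $\hbar$-independent $\tilde\Omega_2\Subset\Omega$ with $\{x:\exists y\in\tilde\Omega_1,\ (x,y)\in\operatorname{supp}K_A\}\subset\tilde\Omega_2$ for all $\hbar\in]0,\hbar_0]$. $A^*$ is the formal adjoint for $(u|v)_{L^2_\Phi}=\int u\bar v\,e^{-2\Phi/\hbar}L(\mathrm dx)$. A uniformly properly supported $A:L^2_{\Phi,\mathrm{loc}}(\Omega)\to L^2_{\Phi,\mathrm{loc}}(\Omega)$ is negligible, $A\equiv_\Phi0$, if there is a continuous $\Phi_2<\Phi$ on $\Omega$ with $A=\mathcal O(1):L^2_{\Phi,\mathrm{loc}}(\Omega)\to L^2_{\Phi_2,\mathrm{loc}}(\Omega)$; $A\equiv_\Phi B$ means $A-B\equiv_\Phi0$. *)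

(* Defs.v *)
From HB Require Import structures.
From mathcomp Require Import all_boot all_order all_algebra complex.
From mathcomp Require Import all_classical all_reals all_analysis.

Set Implicit Arguments.
Unset Strict Implicit.
Unset Printing Implicit Defensive.
Import Order.TTheory GRing.Theory Num.Theory.
Import numFieldNormedType.Exports.
Local Open Scope classical_set_scope.
Local Open Scope complex_scope.
Local Open Scope ring_scope.

(* Lebesgue measure on R^m.  The sigma-algebra on row vectors is generated by
   the coordinates, as the library does for tuples; over R it is the Borel
   sigma-algebra. *)

Section measurable_rV.
Context {d} {T : sigmaRingType d} (m : nat).

Let coors : 'I_m -> 'rV[T]_m -> T := fun i x => x 0 i.

Let rV_set0 : g_sigma_preimage coors set0.
Proof. exact: sigma_algebra0. Qed.

Let rV_setC A : g_sigma_preimage coors A -> g_sigma_preimage coors (~` A).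
Proof. exact: sigma_algebraC. Qed.

Let rV_bigcup (F : (set 'rV[T]_m)^nat) :
  (forall i, g_sigma_preimage coors (F i)) ->
  g_sigma_preimage coors (\bigcup_i F i).
Proof. exact: sigma_algebra_bigcup. Qed.

HB.instance Definition _ := @isMeasurable.Build (measure_tuple_display d)
  'rV[T]_m (g_sigma_preimage coors) rV_set0 rV_setC rV_bigcup.
End measurable_rV.

Lemma measurable_fun_rV d1 d2 (T1 : measurableType d1) (T2 : measurableType d2)
    m (f : T1 -> 'rV[T2]_m) :
  (forall i, measurable_fun setT (fun x => f x 0 i)) -> measurable_fun setT f.
Proof.
move=> mf.
have prefS : g_sigma_preimage (fun i => (fun v : 'rV[T2]_m => v 0 i) \o f)
    `<=` measurable.
  apply: smallest_sub; first exact: sigma_algebra_measurable.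
  case: m => [|m] in f mf *; first by rewrite big_ord0.
  rewrite -bigcup_mkord_ord; apply: bigcup_sub => i Ii.
  by move=> A [B mB <-]; exact: mf.
move=> _ A mA; apply: prefS.
by rewrite g_sigma_preimage_comp; exists A.
Qed.

Lemma measurable_coord_rV d (T : measurableType d) m (i : 'I_m) :
  measurable_fun [set: 'rV[T]_m] (fun v => v 0 i).
Proof.
move=> _ A mA; rewrite setTI; apply: sub_sigma_algebra => /=.
rewrite -bigcup_seq/=; exists i => /=; first by rewrite mem_index_enum.
by exists A => //; rewrite setTI.
Qed.

Section cons_rV.
Context {R : realType} (m : nat).

Definition cons_rV (p : measurableTypeR R * 'rV[R]_m) : 'rV[R]_m.+1 :=
  row_mx ((p.1 : R)%:M : 'rV[R]_1) p.2.

Lemma measurable_cons_rV : measurable_fun setT cons_rV.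
Proof.
apply: measurable_fun_rV => i.
have [j ij|j ij] := @split_ordP 1 m i; rewrite {}ij.
- rewrite (_ : (fun x => _) = (fun x : measurableTypeR R * 'rV[R]_m => x.1)).
    exact: measurable_fst.
  apply/funext => x; apply: (etrans (row_mxEl _ _ _ _)).
  by rewrite mxE (ord1 j) mulr1n.
- rewrite (_ : (fun x => _) =
      (fun v : 'rV[R]_m => v 0 j) \o (fun x : measurableTypeR R * 'rV[R]_m => x.2)).
    apply: measurableT_comp; last exact: measurable_snd.
    exact: measurable_coord_rV.
  by apply/funext => x; exact: row_mxEr.
Qed.

Section step.
Variable mu : {sigma_finite_measure set 'rV[R]_m -> \bar R}.

Definition lebesgue_step : set 'rV[R]_m.+1 -> \bar R :=
  pushforward (@lebesgue_measure R \x mu)%E cons_rV.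

Let step0 : lebesgue_step set0 = 0%E.
Proof. by rewrite /lebesgue_step /pushforward preimage_set0 measure0. Qed.

Let step_ge0 A : (0 <= lebesgue_step A)%E.
Proof. by rewrite /lebesgue_step /pushforward measure_ge0. Qed.

Let mstep A : measurable A -> measurable (cons_rV @^-1` A).
Proof. by move=> mA; rewrite -[X in measurable X]setTI; exact: measurable_cons_rV. Qed.

Let step_sigma_additive : semi_sigma_additive lebesgue_step.
Proof.
move=> F mF tF mUF; rewrite /lebesgue_step /pushforward preimage_bigcup.
apply: measure_semi_sigma_additive.
- by move=> k; exact: mstep.
- apply/trivIsetP => /= i j _ _ ij; rewrite -preimage_setI.
  by move/trivIsetP : tF => /(_ _ _ _ _ ij) ->//; rewrite preimage_set0.
- by rewrite -preimage_bigcup; exact: mstep.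
Qed.

HB.instance Definition _ := isMeasure.Build _ _ _ lebesgue_step
  step0 step_ge0 step_sigma_additive.

Let step_sigma_finite : sigma_finite setT lebesgue_step.
Proof.
have [E ET Eoo] : sigma_finite setT (@lebesgue_measure R \x mu)%E.
  have /sigma_finiteP[F [TF ndF Foo]] := sigma_finiteT (@lebesgue_measure R).
  have /sigma_finiteP[G [TG ndG Goo]] := sigma_finiteT mu.
  exists (fun k => F k `*` G k).
    rewrite -setXTT TF TG predeqE => -[x y]; split.
      move=> [/= [k _ Fx] [l _ Gy]]; exists (maxn k l) => //; split.
      - by move: x Fx; exact/subsetPset/ndF/leq_maxl.
      - by move: y Gy; exact/subsetPset/ndG/leq_maxr.
    by move=> [k _ []/= ? ?]; split; exists k.
  move=> k; have [? ?] := Foo k; have [? ?] := Goo k.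
  split; first exact: measurableX.
  by rewrite product_measure1E// lte_mul_pinfty// ge0_fin_numE.
pose uncons (v : 'rV[R]_m.+1) : (measurableTypeR R * 'rV[R]_m)%type :=
  (v 0 ord0, \row_j v 0 (rshift 1 j)).
have consK : cancel cons_rV uncons.
  move=> [x v]; congr pair => /=.
    have -> : ord0 = lshift m (ord0 : 'I_1) :> 'I_m.+1 by exact: val_inj.
    by apply: (etrans (row_mxEl _ _ _ _)); rewrite mxE mulr1n.
  by apply/rowP => j; rewrite mxE; exact: row_mxEr.
have munc : measurable_fun setT uncons.
  apply/measurable_fun_pair; first exact: measurable_coord_rV.
  apply: measurable_fun_rV => j.
  rewrite (_ : (fun x => _) = fun v : 'rV[R]_m.+1 => v 0 (rshift 1 j)).
    exact: measurable_coord_rV.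
  by apply/funext => v; rewrite mxE.
exists (fun k => uncons @^-1` E k).
  by rewrite -preimage_bigcup -ET preimage_setT.
move=> k; have [mE Efin] := Eoo k; split.
  by rewrite -[X in measurable X]setTI; exact: munc.
rewrite /lebesgue_step /pushforward -comp_preimage.
by rewrite (_ : uncons \o cons_rV = id) ?preimage_id//; apply/funext.
Qed.

HB.instance Definition _ := Measure_isSigmaFinite.Build _ _ _ lebesgue_step
  step_sigma_finite.
End step.
End cons_rV.

Fixpoint lebesgue_rV {R : realType} (m : nat) :
    {sigma_finite_measure set 'rV[R]_m -> \bar R} :=
  match m with
  | 0 => dirac (0 : 'rV[R]_0)
  | m'.+1 => lebesgue_step (lebesgue_rV m')
  end.

(* C^n is R^(2n): the point z = x + i y has row of coordinates (x, y), so x_j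
   has index [lshift n j] and y_j has index [rshift n j]. *)
Notation Cn R n := ('rV[R]_(n + n)%N).

Section calculus.
Context {R : realType}.

Section real_coordinates.
Context {m : nat}.
Implicit Types (W : set 'rV[R]_m) (f : 'rV[R]_m -> R) (u : 'rV[R]_m -> R[i]).

Definition partial (i : 'I_m) f : 'rV[R]_m -> R := 'D_(delta_mx 0 i) f.

Definition iter_partial (s : seq 'I_m) f := foldr partial f s.

Definition Ck_on (k : nat) W f := forall s : seq 'I_m, (size s <= k)%N ->
  {within W, continuous (iter_partial s f)} /\
  ((size s < k)%N -> forall i x, W x ->
     derivable (iter_partial s f) x (delta_mx 0 i)).

Definition partial_sum (c : {ffun 'I_m -> nat} -> R) (h : 'I_m -> R) : R^nat :=
  fun N => \sum_(a : {ffun 'I_m -> 'I_N.+1})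
    c [ffun i => a i : nat] * \prod_i h i ^+ a i.

(* f is near every point of W the sum of an absolutely convergent power
   series *)
Definition real_analytic_on W f := forall z, W z ->
  exists (c : {ffun 'I_m -> nat} -> R) (r : R), 0 < r /\
    forall x, ball z r x ->
      cvgn (partial_sum (fun a => `|c a|) (fun i => `|x 0 i - z 0 i|)) /\
      partial_sum c (fun i => x 0 i - z 0 i) @ \oo --> f x.

Definition cpartial (i : 'I_m) u : 'rV[R]_m -> R[i] := fun x =>
  partial i (fun y => complex.Re (u y)) x +i*
  partial i (fun y => complex.Im (u y)) x.

Definition csmooth u := forall k,
  Ck_on k setT (fun x => complex.Re (u x)) /\
  Ck_on k setT (fun x => complex.Im (u x)).

Definition csupp u := closure [set x | u x != 0].

(* C_c^oo(W), extended by zero to the whole space *)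
Definition test_function W u :=
  [/\ csmooth u, compact (csupp u) & csupp u `<=` W].

Definition distribution W (K : ('rV[R]_m -> R[i]) -> R[i]) :=
  (forall (a : R[i]) phi psi, test_function W phi -> test_function W psi ->
     K (fun x => a * phi x + psi x) = a * K phi + K psi) /\
  (forall S, compact S -> S `<=` W ->
     exists (C : R) (N : nat), forall phi (M : R),
       test_function W phi -> csupp phi `<=` S ->
       (forall (s : seq 'I_m) x, (size s <= N)%N ->
          Normc.normc (foldr cpartial phi s x) <= M) ->
       Normc.normc (K phi) <= C * M).

Definition distribution_supp W (K : ('rV[R]_m -> R[i]) -> R[i]) :=
  [set p | W p /\ forall V, open V -> V p ->
     exists phi, test_function (W `&` V) phi /\ K phi != 0].

(* W' is relatively compact in W *)
Definition rel_compact W' W := compact (closure W') /\ closure W' `<=` W.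

Definition cintegral W u : R[i] :=
  (\int[lebesgue_rV m]_(x in W) complex.Re (u x)) +i*
  (\int[lebesgue_rV m]_(x in W) complex.Im (u x)).

(* Elements of L^2_loc(W) are represented by functions on the whole space, of
   which only the values on W are relevant, up to equality a.e. on W. *)
Definition L2loc W u :=
  [/\ measurable_fun W (fun x => complex.Re (u x)),
      measurable_fun W (fun x => complex.Im (u x))
    & forall D, measurable D -> rel_compact D W ->
        (\int[lebesgue_rV m]_(x in D) (Normc.normc (u x) ^+ 2)%:E < +oo)%E].

Definition eq_ae W u v := u = v %[ae lebesgue_rV m in W].

(* a linear operator on the quotient of L^2_loc(W) by a.e. equality *)
Definition L2loc_operator W (A : ('rV[R]_m -> R[i]) -> 'rV[R]_m -> R[i]) :=
  [/\ forall u, L2loc W u -> L2loc W (A u),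
      forall u v, L2loc W u -> L2loc W v -> eq_ae W u v -> eq_ae W (A u) (A v)
    & forall (a : R[i]) u v, L2loc W u -> L2loc W v ->
        eq_ae W (A (fun x => a * u x + v x)) (fun x => a * A u x + A v x)].

Definition compactly_supported_in W u :=
  exists S, [/\ compact S, S `<=` W & forall x, W x -> ~ S x -> u x = 0].

Definition L2norm (Phi : 'rV[R]_m -> R) (h : R) (D : set 'rV[R]_m) u : \bar R :=
  ((\int[lebesgue_rV m]_(x in D)
      (Normc.normc (u x) ^+ 2 * expR (- 2 * Phi x / h))%:E) `^ 2^-1)%E.

End real_coordinates.

Section kernels.
Context {m : nat} (W : set 'rV[R]_m).

Definition square_set : set 'rV[R]_(m + m) :=
  [set p | W (lsubmx p) /\ W (rsubmx p)].

Definition tensor (phi psi : 'rV[R]_m -> R[i]) : 'rV[R]_(m + m) -> R[i] :=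
  fun p => phi (lsubmx p) * psi (rsubmx p).

(* K is the Schwartz kernel of A, with (A psi)(x) = \int K(x, y) psi(y) dy *)
Definition is_kernel (A : ('rV[R]_m -> R[i]) -> 'rV[R]_m -> R[i])
    (K : ('rV[R]_(m + m) -> R[i]) -> R[i]) :=
  distribution square_set K /\
  forall phi psi, test_function W phi -> test_function W psi ->
    K (tensor phi psi) = cintegral W (fun x => A psi x * phi x).

Definition kernel_supp K : set ('rV[R]_m * 'rV[R]_m) :=
  [set p | distribution_supp square_set K (row_mx p.1 p.2)].

End kernels.
End calculus.

Section complex_coordinates.
Context {R : realType} {n : nat}.
Implicit Types (W D : set (Cn R n)) (u : Cn R n -> R[i]).

Definition dz (j : 'I_n) u : Cn R n -> R[i] := fun z =>
  2^-1 * (cpartial (lshift n j) u z - 'i%C * cpartial (rshift n j) u z).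

Definition dzbar (j : 'I_n) u : Cn R n -> R[i] := fun z =>
  2^-1 * (cpartial (lshift n j) u z + 'i%C * cpartial (rshift n j) u z).

Definition levi_form (Phi : Cn R n -> R) (z : Cn R n) (xi : 'rV[R[i]]_n) :=
  \sum_(j < n) \sum_(k < n)
    dz j (dzbar k (fun y => (Phi y)%:C)) z * xi 0 j * conjc (xi 0 k).

Definition strictly_psh W (Phi : Cn R n -> R) :=
  Ck_on 2 W Phi /\
  forall z xi, W z -> xi != 0 -> 0 < levi_form Phi z xi.

(* f is the derivative of u with respect to \bar z_j in the sense of
   distributions on W *)
Definition weak_dzbar W (j : 'I_n) u (f : Cn R n -> R[i]) :=
  forall phi, test_function W phi ->
    cintegral W (fun z => u z * dzbar j phi z) =
    - cintegral W (fun z => f z * phi z).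

(* the j-th component of \bar\partial u, when it is in L^2_loc *)
Definition dbar W u (j : 'I_n) : Cn R n -> R[i] :=
  xget (fun=> 0) [set f | L2loc W f /\ weak_dzbar W j u f].

Definition dbar_L2norm W (Phi : Cn R n -> R) (h : R) D u : \bar R :=
  ((\int[lebesgue_rV (n + n)]_(z in D)
      ((\sum_(j < n) (h * Normc.normc (dbar W u j z)) ^+ 2) *
       expR (- 2 * Phi z / h))%:E) `^ 2^-1)%E.

Record semiclassical_space := SemiclassicalSpace {
  sc_mem : (Cn R n -> R[i]) -> Prop ;
  sc_seminorm : R -> set (Cn R n) -> (Cn R n -> R[i]) -> \bar R }.

Variable Omega : set (Cn R n).
Implicit Types Phi : Cn R n -> R.

Definition L2_Phi_loc Phi := SemiclassicalSpace (L2loc Omega) (L2norm Phi).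

Definition H_Phi_loc Phi Phi1 := SemiclassicalSpace
  (fun u => L2loc Omega u /\
     forall j, exists f, L2loc Omega f /\ weak_dzbar Omega j u f)
  (fun h D u => L2norm Phi h D u + dbar_L2norm Omega Phi1 h D u)%E.

(* A semiclassical family of operators is a function of h; only its values for
   0 < h <= 1 are relevant. *)
Definition operator_family := R -> (Cn R n -> R[i]) -> Cn R n -> R[i].
Implicit Types A B : operator_family.

Definition sub_family A B : operator_family := fun h u z => A h u z - B h u z.

Definition id_family : operator_family := fun _ u => u.

(* A = O(1) : X -> Y *)
Definition bigO1 (X Y : semiclassical_space) A :=
  exists h0 : R, [/\ 0 < h0 <= 1,
    forall h u, 0 < h <= h0 -> sc_mem X u -> sc_mem Y (A h u)
  & forall D2, measurable D2 -> rel_compact D2 Omega ->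
      exists D1 (C : R),
        [/\ measurable D1, rel_compact D1 Omega, 0 < C
          & forall h u, 0 < h <= h0 -> sc_mem X u ->
              (sc_seminorm Y h D2 (A h u) <= C%:E * sc_seminorm X h D1 u)%E]].

Definition uniformly_properly_supported A :=
  exists h0 : R, 0 < h0 <= 1 /\
  exists K : R -> ('rV[R]_((n + n) + (n + n)) -> R[i]) -> R[i],
    [/\ forall h, 0 < h <= h0 -> is_kernel Omega (A h) (K h),
        forall D2, rel_compact D2 Omega ->
          exists D1, rel_compact D1 Omega /\ forall h, 0 < h <= h0 ->
            [set y | exists x, D2 x /\ kernel_supp Omega (K h) (x, y)] `<=` D1
      & forall D1, rel_compact D1 Omega ->
          exists D2, rel_compact D2 Omega /\ forall h, 0 < h <= h0 ->
            [set x | exists y, D1 y /\ kernel_supp Omega (K h) (x, y)] `<=` D2].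

Definition inner_Phi Phi (h : R) u v : R[i] :=
  cintegral Omega
    (fun z => u z * conjc (v z) * (expR (- 2 * Phi z / h))%:C).

(* B = A^* for all small h *)
Definition formal_adjoint Phi A B :=
  exists h0 : R, 0 < h0 <= 1 /\ forall h u v, 0 < h <= h0 ->
    L2loc Omega u -> compactly_supported_in Omega u ->
    L2loc Omega v -> compactly_supported_in Omega v ->
    inner_Phi Phi h (A h u) v = inner_Phi Phi h u (B h v).

Definition continuous_below Phi Phi' :=
  {within Omega, continuous Phi'} /\ forall z, Omega z -> Phi' z < Phi z.

Definition negligible_family Phi A :=
  uniformly_properly_supported A /\
  exists Phi2, continuous_below Phi Phi2 /\
    bigO1 (L2_Phi_loc Phi) (L2_Phi_loc Phi2) A.

Definition equiv_Phi Phi A B := negligible_family Phi (sub_family A B).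

Definition L2loc_family A :=
  forall h, 0 < h <= 1 -> L2loc_operator Omega (A h).

Record asymptotic_projection Phi A : Prop := {
  ap_bounded : exists Phi1, continuous_below Phi Phi1 /\
    bigO1 (L2_Phi_loc Phi) (H_Phi_loc Phi Phi1) A ;
  ap_supported : uniformly_properly_supported A ;
  ap_selfadjoint : exists Astar,
    [/\ L2loc_family Astar, formal_adjoint Phi A Astar
      & equiv_Phi Phi A Astar] ;
  ap_reproducing : forall Phi1, continuous_below Phi Phi1 ->
    exists Phi2, continuous_below Phi Phi2 /\
      bigO1 (H_Phi_loc Phi Phi1) (L2_Phi_loc Phi2) (sub_family A id_family) }.

End complex_coordinates.
Arguments operator_family R n : clear implicits.

(* Main.v *)
(** Write A and P for the two operators, A' and P' for their adjoints.  The
    reproducing property applied to the ranges gives A P - P and P A - A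
    negligible, and
      P - A = - (A P - P) + (A' P' - A') - (A - A') (1 - P) + A' (P - P'),
    where A' P' - A' is the adjoint of P A - A.

    Two remarks make this elementary.  By compactness, an operator is O(1) into
    some L^2_{Phi2,loc} with Phi2 < Phi iff each of its seminorm estimates in
    L^2_{Phi,loc} gains a factor exp(- s / h), with s > 0 depending on the
    compact set; this form is stable under composition with O(1) operators and
    under adjunction.  And an O(1) estimate of A u on D by u on E makes A u on D
    depend only on u on E and, by duality, makes A' v vanish outside E when v
    lives on D, so that all truncations in the duality arguments are justified
    without looking at the kernels. *)

Require Import Defs.
From mathcomp Require Import all_boot all_order all_algebra complex.
From mathcomp Require Import all_classical all_reals all_analysis.
From mathcomp Require Import measurable_realfun ring lra.
Import Order.TTheory GRing.Theory Num.Theory.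
Import numFieldNormedType.Exports.

Set Implicit Arguments.
Unset Strict Implicit.
Unset Printing Implicit Defensive.
Local Open Scope classical_set_scope.
Local Open Scope complex_scope.
Local Open Scope ring_scope.

(** * Borel sets and Lebesgue measure on R^m *)

Section rV_measurability.
Context {R : realType} {m : nat}.
Implicit Types (x y : 'rV[R]_m) (A U : set 'rV[R]_m).

Lemma measurable_cube x e : measurable [set y | ball x e y].
Proof.
(* The ball of row vectors carries the condition [0 < e]; for [m = 0] the coordinate conditions
   alone would not make a ball of nonpositive radius empty. *)
have [e0|e0] := ltP 0 e; last first.
  rewrite (_ : [set y | ball x e y] = set0)//.
  by apply/seteqP; split => // y [/=]; rewrite ltNge e0.
rewrite (_ : [set y | ball x e y] =
    \bigcap_(i in [set: 'I_m]) [set y | ball (x 0 i) e (y 0 i)]).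
  apply: fin_bigcap_measurable => // i _.
  rewrite -[X in measurable X]setTI.
  exact: (measurable_coord_rV i measurableT (measurable_ball (x 0 i) e)).
apply/seteqP; split => [y [_ xy] i _|y xy]; first exact: xy.
by split => // i j; rewrite (ord1 i); exact: xy.
Qed.

(** The sigma-algebra is generated by the coordinates, so second countability has to be used: an
    open set is the union of the countably many balls with rational centre and radius 1/(k+1) that
    it contains. *)
Lemma open_measurable_rV U : open U -> measurable U.
Proof.
move=> oU.
pose q (p : 'rV[rat]_m * nat) : 'rV[R]_m := map_mx ratr p.1.
pose F p := if `[< [set y | ball (q p) p.2.+1%:R^-1 y] `<=` U >]
  then [set y | ball (q p) p.2.+1%:R^-1 y] else set0.
suff -> : U = \bigcup_p F p.
  apply: countable_bigcupT_measurable => // p; rewrite /F.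
  by case: ifP => _ //; exact: measurable_cube.
apply/seteqP; split => [x Ux|x [p _]]; last first.
  by rewrite /F; case: ifPn => // /asboolP; exact.
have /nbhs_ballP[e /= e0 xeU] : nbhs x U by move: oU; rewrite openE; exact.
(* Half of [e], because the rational ball only contains [x] and is not centred there. *)
have [k ke] : exists k : nat, k.+1%:R^-1 < e / 2 :> R.
  have e20 : 0 < e / 2 by rewrite divr_gt0.
  have [k _ kP] := near_infty_natSinv_lt (PosNum e20).
  by exists k; apply: (kP k) => /=.
have /choice[r rP] (i : 'I_m) : exists r : rat,
    `|ratr r - x 0 i| < k.+1%:R^-1.
  have /rat_in_itvoo[r] : x 0 i - k.+1%:R^-1 < x 0 i + k.+1%:R^-1.
    by rewrite ltrD2l gtrN ?invr_gt0 ?ltr0n.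
  by rewrite in_itv /= => rx; exists r; rewrite ltr_distl.
pose p := (\row_i r i, k).
have qx : ball (q p) k.+1%:R^-1 x.
  split; first by rewrite invr_gt0 ltr0n.
  by move=> i j; rewrite (ord1 i) /ball /= /q !mxE.
exists p => //; rewrite /F; case: ifPn => // /asboolP; elim => y qy.
apply: xeU; rewrite [e]splitr; apply: (@ball_triangle _ _ (q p)).
  by apply: ball_sym; apply: le_ball qx; exact: ltW.
by apply: le_ball qy; exact: ltW.
Qed.

Lemma closed_measurable_rV A : closed A -> measurable A.
Proof.
by move=> cA; rewrite -(setCK A); apply: measurableC; apply: open_measurable_rV;
  exact: closed_openC.
Qed.

Lemma continuous_within_measurable U (f : 'rV[R]_m -> R) :
  open U -> {within U, continuous f} -> measurable_fun U f.
Proof.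
move=> oU /continuousP cf.
apply: (measurability _ (RGenOpens.measurableE R)).
move=> _ [_ [a [b ->] <-]].
have /cf/open_subspaceP[V oV VD] : open (`]a, b[%classic : set R) by exact: interval_open.
rewrite setIC -VD; apply: open_measurable_rV; exact: openI.
Qed.

End rV_measurability.

Lemma measurable_box (R : realType) m (M : R) :
  measurable [set x : 'rV[R]_m | forall i, `|x 0 i| <= M].
Proof.
rewrite (_ : [set x | _] = \bigcap_(i in [set: 'I_m])
    [set x : 'rV[R]_m | `|x 0 i| <= M]).
  apply: fin_bigcap_measurable => // i _.
  rewrite -[X in measurable X]setTI.
  rewrite (_ : [set x | _] = (fun x : 'rV[R]_m => x 0 i) @^-1` `[- M, M]).
    exact: measurable_coord_rV.
  by apply/seteqP; split => x /=; rewrite in_itv /= ler_norml.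
by apply/seteqP; split => [y yB i _|y yB i]; exact: yB.
Qed.

(** By induction on the dimension: [cons_rV] pulls the box back to the product of an interval and
    the box of dimension [m]. This makes relatively compact sets of finite measure. *)
Lemma lebesgue_rV_bounded (R : realType) m (M : R) :
  (lebesgue_rV m [set x : 'rV[R]_m | forall i, `|x 0 i| <= M]%R < +oo)%E.
Proof.
elim: m => [|m IHm] /=.
  rewrite diracE; apply: (@le_lt_trans _ _ 1%E); last exact: ltry.
  by rewrite lee_fin; case: (_ \in _).
rewrite /lebesgue_step /pushforward.
set B := [set x : 'rV[R]_m | forall i, `|x 0 i| <= M].
have mB : measurable B by exact: measurable_box.
have cons0 (p : measurableTypeR R * 'rV[R]_m) (j : 'I_1) :
    cons_rV p 0 (lshift m j) = p.1.
  by rewrite (ord1 j); apply: (etrans (row_mxEl _ _ _ _)); rewrite mxE mulr1n.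
have consS (p : measurableTypeR R * 'rV[R]_m) j :
    cons_rV p 0 (rshift 1 j) = p.2 0 j by exact: row_mxEr.
rewrite (_ : _ @^-1` _ = `[- M, M] `*` B); last first.
  apply/seteqP; split => [p /= pM|p [/= pM pB] i].
    split => [|i]; last by have := pM (rshift 1 i); rewrite consS.
    by have := pM (lshift m (ord0 : 'I_1)); rewrite cons0 in_itv /= ler_norml.
  have [j ->|j ->] := @split_ordP 1 m i; last by rewrite consS; exact: pB.
  by rewrite cons0; move: pM; rewrite in_itv /= ler_norml.
rewrite product_measure1E // lte_mul_pinfty //.
suff : (@lebesgue_measure R `[(- M)%R, M]%classic < +oo)%E.
  by rewrite ge0_fin_numE.
by rewrite lebesgue_measure_itv /=; case: ifP => _; rewrite ?ltry // -EFinN -EFinD ltry.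
Qed.

Lemma normc2E (R : realType) (z : R[i]) :
  Normc.normc z ^+ 2 = complex.Re z ^+ 2 + complex.Im z ^+ 2.
Proof. by case: z => a b; rewrite /= sqr_sqrtr // addr_ge0 // sqr_ge0. Qed.

(** * Weighted norms *)

Section weighted_norm.
Context {R : realType} {m : nat}.
Variables (Omega : set 'rV[R]_m) (Phi : 'rV[R]_m -> R).
Hypothesis oOmega : open Omega.
Hypothesis cPhi : {within Omega, continuous Phi}.
Implicit Types (D : set 'rV[R]_m) (u v : 'rV[R]_m -> R[i]) (h : R).

Let mu := lebesgue_rV m : {sigma_finite_measure set 'rV[R]_m -> \bar R}.

Definition good D := measurable D /\ rel_compact D Omega.

Lemma good_measurable D : good D -> measurable D. Proof. by case. Qed.

Lemma good_subset D D' : measurable D -> D `<=` D' -> good D' -> good D.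
Proof.
move=> mD DD' [_ [cD' D'O]].
have cl : closure D `<=` closure D' by exact: closure_subset.
split=> //; split; last exact: subset_trans D'O.
by apply: (@subclosed_compact _ (closure D) (closure D')) => //; exact: closed_closure.
Qed.

Lemma rel_compactU D D' : rel_compact D Omega -> rel_compact D' Omega ->
  rel_compact (D `|` D') Omega.
Proof.
move=> [cD DO] [cD' D'O]; rewrite /rel_compact closureU; split.
  exact: compactU.
by rewrite subUset.
Qed.

Lemma goodU D D' : good D -> good D' -> good (D `|` D').
Proof.
by move=> [mD cD] [mD' cD']; split; [exact: measurableU|exact: rel_compactU].
Qed.

Lemma goodD D D' : good D -> good D' -> good (D `\` D').
Proof.
move=> gD [mD' _]; apply: good_subset (gD); last exact: subDsetl.
by apply: measurableD => //; exact: good_measurable.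
Qed.

Lemma good0 : good set0.
Proof. by split => //; split; rewrite closure0 //; exact: compact0. Qed.

Lemma good_sub D : good D -> D `<=` Omega.
Proof. by move=> [_ [_ cO]]; apply: subset_trans cO; exact: subset_closure. Qed.

Lemma good_bounded_above D (f : 'rV[R]_m -> R) : good D ->
  {within Omega, continuous f} -> exists M, forall x, D x -> f x <= M.
Proof.
move=> [_ [cD DO]] cf.
have [nD|nD] := pselect (closure D !=set0); last first.
  by exists 0 => x Dx; case: nD; exists x; exact: subset_closure.
have [c _ cM] := compact_EVT_max nD cD (continuous_subspaceW DO cf).
by exists (f c) => x Dx; apply: cM; rewrite inE; exact: subset_closure.
Qed.

Lemma measurable_Omega : measurable Omega.
Proof. exact: open_measurable_rV. Qed.

Definition weight h (z : 'rV[R]_m) := expR (- 2 * Phi z / h).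

Lemma weight_gt0 h z : 0 < weight h z. Proof. exact: expR_gt0. Qed.
Lemma weight_ge0 h z : 0 <= weight h z. Proof. exact: expR_ge0. Qed.

Lemma measurable_weight h : measurable_fun Omega (weight h).
Proof.
apply: measurableT_comp => //; apply: measurable_funM => //.
by apply: measurable_funM => //; exact: continuous_within_measurable.
Qed.

(** This is the real part of u times the conjugate of v. It suffices for duality, since only squared
    norms are recovered from the pairing. *)
Definition re_dot u v z : R :=
  complex.Re (u z) * complex.Re (v z) + complex.Im (u z) * complex.Im (v z).

(** The square of [L2norm], kept free of roots. It is extended-real, so that monotonicity needs no
    finiteness; [weighted_norm2_dot] links it to the real-valued pairing. *)
Definition weighted_norm2 h D u : \bar R :=
  \int[mu]_(z in D) (Normc.normc (u z) ^+ 2 * weight h z)%:E.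

Definition weighted_dot h D u v : R :=
  \int[mu]_(z in D) (re_dot u v z * weight h z).

Lemma re_dotC u v z : re_dot u v z = re_dot v u z.
Proof. by rewrite /re_dot mulrC [X in _ + X]mulrC. Qed.

Lemma re_dotuu u z : re_dot u u z = Normc.normc (u z) ^+ 2.
Proof. by rewrite normc2E /re_dot !expr2. Qed.

Lemma measurable_re_dot u v : L2loc Omega u -> L2loc Omega v ->
  measurable_fun Omega (re_dot u v).
Proof.
by move=> [mRu mIu _] [mRv mIv _]; apply: measurable_funD; exact: measurable_funM.
Qed.

Lemma measurable_normc2 u : L2loc Omega u ->
  measurable_fun Omega (fun z => Normc.normc (u z) ^+ 2).
Proof.
move=> Lu; rewrite (_ : (fun z => _) = re_dot u u).
  exact: measurable_re_dot.
by apply/funext => z; rewrite re_dotuu.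
Qed.

Lemma measurable_good D (f : 'rV[R]_m -> R) : good D ->
  measurable_fun Omega f -> measurable_fun D f.
Proof.
by move=> gD; apply: measurable_funS; [exact: measurable_Omega|exact: good_sub].
Qed.

Lemma integrable_normc2 D u : good D -> L2loc Omega u ->
  mu.-integrable D (fun z => (Normc.normc (u z) ^+ 2)%:E).
Proof.
move=> gD Lu; apply/integrableP; split.
  apply/measurable_EFinP; apply: measurable_good => //; exact: measurable_normc2.
have [_ _ /(_ D (good_measurable gD) gD.2)] := Lu.
apply: le_lt_trans; rewrite le_eqVlt; apply/orP; left; apply/eqP.
by apply: eq_integral => z _; rewrite gee0_abs // lee_fin sqr_ge0.
Qed.

Lemma L2locI u : measurable_fun Omega (fun x => complex.Re (u x)) ->
  measurable_fun Omega (fun x => complex.Im (u x)) ->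
  (forall D, good D -> exists2 g, mu.-integrable D (EFin \o g) &
    forall z, D z -> Normc.normc (u z) ^+ 2 <= g z) -> L2loc Omega u.
Proof.
move=> mR mI ug; split => // D mD cD.
have gD : good D by [].
have [g /integrableP[mg fg] leg] := ug D gD.
apply: le_lt_trans fg; apply: ge0_le_integral => //.
- by move=> z Dz; rewrite lee_fin sqr_ge0.
- apply/measurable_EFinP; apply: measurable_good => //.
  rewrite (_ : (fun z => _) = (fun z => complex.Re (u z) ^+ 2 + complex.Im (u z) ^+ 2)).
    by apply: measurable_funD; exact: measurable_funX.
  by apply/funext => z; rewrite normc2E.
- exact: measurableT_comp.
- by move=> z Dz; rewrite /= lee_fin (le_trans (leg _ Dz)) // ler_norm.
Qed.

(** Parallelogram identity: the two sides differ by the squared modulus of a y - z. *)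
Lemma sqr_normc_lin (a y z : R[i]) : Normc.normc (a * y + z) ^+ 2 <=
  2 * Normc.normc a ^+ 2 * Normc.normc y ^+ 2 + 2 * Normc.normc z ^+ 2.
Proof.
rewrite !normc2E; case: a y z => [a b] [c d] [e f] /=; rewrite -subr_ge0.
have -> : 2 * (a ^+ 2 + b ^+ 2) * (c ^+ 2 + d ^+ 2) + 2 * (e ^+ 2 + f ^+ 2) -
  ((a * c - b * d + e) ^+ 2 + (a * d + b * c + f) ^+ 2) =
  (a * c - b * d - e) ^+ 2 + (a * d + b * c - f) ^+ 2 by ring.
by rewrite addr_ge0 // sqr_ge0.
Qed.

Lemma L2loc_lin (a : R[i]) u v : L2loc Omega u -> L2loc Omega v ->
  L2loc Omega (fun z => a * u z + v z).
Proof.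
move=> Lu Lv; have [mRu mIu _] := Lu; have [mRv mIv _] := Lv; apply: L2locI.
- rewrite (_ : (fun z => _) = (fun z => (complex.Re a * complex.Re (u z) -
    complex.Im a * complex.Im (u z)) + complex.Re (v z))); last first.
    by apply/funext => z; case: a (u z) (v z) => [? ?] [? ?] [? ?].
  by apply: measurable_funD => //; apply: measurable_funB; exact: measurable_funM.
- rewrite (_ : (fun z => _) = (fun z => (complex.Re a * complex.Im (u z) +
    complex.Im a * complex.Re (u z)) + complex.Im (v z))); last first.
    by apply/funext => z; case: a (u z) (v z) => [? ?] [? ?] [? ?].
  by apply: measurable_funD => //; apply: measurable_funD; exact: measurable_funM.
- move=> D gD; eexists; last by move=> z _; exact: sqr_normc_lin.
  have mD := good_measurable gD.
  rewrite [X in _.-integrable _ X](_ : _ = (fun z => (2 * Normc.normc a ^+ 2)%:E *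
    (Normc.normc (u z) ^+ 2)%:E + 2%:E * (Normc.normc (v z) ^+ 2)%:E)%E).
    by apply: integrableD => //; apply: integrableZl => //; exact: integrable_normc2.
  by apply/funext => z.
Qed.

Lemma L2loc0 : L2loc Omega (fun=> 0).
Proof.
apply: L2locI; [exact: measurable_cst|exact: measurable_cst|move=> D gD].
exists (fun=> 0); first exact: integrable0.
by move=> z _; rewrite normc2E /= expr0n addr0.
Qed.

Lemma L2locB u v : L2loc Omega u -> L2loc Omega v ->
  L2loc Omega (fun z => u z - v z).
Proof.
move=> Lu Lv; rewrite (_ : (fun z => _) = (fun z => -1 * v z + u z)).
  exact: L2loc_lin.
by apply/funext => z; rewrite mulN1r addrC.
Qed.

(** For [D] relatively compact in [Omega], this truncation has the compact support that
    [formal_adjoint] asks of its arguments. *)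
Definition cut D u z : R[i] := if z \in D then u z else 0.

Lemma cut_in D u z : D z -> cut D u z = u z.
Proof. by move=> Dz; rewrite /cut mem_set. Qed.

Lemma cut_out D u z : ~ D z -> cut D u z = 0.
Proof. by move=> Dz; rewrite /cut memNset. Qed.

Lemma L2loc_cut D u : measurable D -> L2loc Omega u -> L2loc Omega (cut D u).
Proof.
move=> mD Lu; have [mRu mIu _] := Lu.
have mcut (f : 'rV[R]_m -> R) :
    measurable_fun Omega f -> measurable_fun Omega (f \_ D).
  move=> mf; apply: (measurable_restrict f mD measurable_Omega).1.
  apply: measurable_funS mf => //; exact: measurable_Omega.
apply: L2locI.
- rewrite (_ : (fun z => _) = (fun z => complex.Re (u z)) \_ D).
    exact: mcut.
  by apply/funext => z; rewrite /cut patchE; case: ifP.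
- rewrite (_ : (fun z => _) = (fun z => complex.Im (u z)) \_ D).
    exact: mcut.
  by apply/funext => z; rewrite /cut patchE; case: ifP.
- move=> E gE; exists (fun z => Normc.normc (u z) ^+ 2).
    exact: integrable_normc2.
  move=> z _; rewrite /cut; case: ifP => // _.
  by rewrite [leLHS]normc2E /= expr0n addr0 sqr_ge0.
Qed.

Lemma compactly_supported_cut D u : good D ->
  compactly_supported_in Omega (cut D u).
Proof.
move=> gD; exists (closure D); have [_ [cD DO]] := gD; split => // z _ Dz.
by apply: cut_out => /subset_closure.
Qed.

End weighted_norm.

(** * Estimates for the weighted norm and the weighted pairing *)

Section weighted_norm_theory.
Context {R : realType} {m : nat}.
Variables (Omega : set 'rV[R]_m) (Phi : 'rV[R]_m -> R).
Hypothesis oOmega : open Omega.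
Hypothesis cPhi : {within Omega, continuous Phi}.
Implicit Types (D : set 'rV[R]_m) (u v : 'rV[R]_m -> R[i]) (h : R).

Let mu := lebesgue_rV m : {sigma_finite_measure set 'rV[R]_m -> \bar R}.
Local Notation good := (good Omega).
Local Notation weight := (weight Phi).
Local Notation wn2 := (weighted_norm2 Phi).
Local Notation wdot := (weighted_dot Phi).
Local Notation L2loc := (L2loc Omega).

Lemma continuous_weight h : {within Omega, continuous (weight h)}.
Proof.
move=> z.
have c : {for z, continuous (fun x : subspace Omega => - 2 * Phi x / h)}.
  apply: continuousM; last exact: cst_continuous.
  by apply: continuousM; [exact: cst_continuous|exact: cPhi].
exact: (continuous_comp c (@continuous_expR R _)).
Qed.

Lemma weight_bounded h D : good D -> exists M, forall z, D z -> weight h z <= M.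
Proof. by move=> gD; apply: (good_bounded_above gD); exact: continuous_weight. Qed.

Lemma measurable_normc2_weight h D u : good D -> L2loc u ->
  measurable_fun D (fun z => (Normc.normc (u z) ^+ 2 * weight h z)%:E).
Proof.
move=> gD Lu; apply/measurable_EFinP; apply: (measurable_good oOmega gD).
by apply: measurable_funM; [exact: measurable_normc2|exact: measurable_weight].
Qed.

Lemma normc2_weight_ge0 h u z : (0 <= (Normc.normc (u z) ^+ 2 * weight h z)%:E)%E.
Proof. by rewrite lee_fin mulr_ge0 ?sqr_ge0 ?weight_ge0. Qed.

(** For fixed [h] the continuous weight is bounded on a relatively compact set, so integrability
    reduces to the unweighted case. *)
Lemma integrable_normc2_weight h D u : good D -> L2loc u ->
  mu.-integrable D (fun z => (Normc.normc (u z) ^+ 2 * weight h z)%:E).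
Proof.
move=> gD Lu; have [M wM] := weight_bounded h gD.
have mD := good_measurable gD.
apply: (@le_integrable _ _ _ _ _ mD _ (fun z => (M%:E * (Normc.normc (u z) ^+ 2)%:E)%E)).
- exact: measurable_normc2_weight.
- move=> z Dz; rewrite -EFinM !abse_EFin lee_fin !ger0_norm.
  + by rewrite [leRHS]mulrC ler_wpM2l ?sqr_ge0 ?wM.
  + by rewrite mulr_ge0 ?sqr_ge0 // (le_trans (weight_ge0 Phi h z)) ?wM.
  + by rewrite mulr_ge0 ?sqr_ge0 ?weight_ge0.
- by apply: integrableZl => //; exact: (integrable_normc2 oOmega).
Qed.

Lemma weighted_norm2_ge0 h D u : (0 <= wn2 h D u)%E.
Proof. by apply: integral_ge0 => z _; exact: normc2_weight_ge0. Qed.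

Lemma weighted_norm2_fin h D u : good D -> L2loc u -> wn2 h D u \is a fin_num.
Proof.
move=> gD Lu; apply: integrable_fin_num; first exact: good_measurable gD.
exact: integrable_normc2_weight.
Qed.

Lemma weighted_norm2_dot h D u : good D -> L2loc u ->
  wn2 h D u = (wdot h D u u)%:E.
Proof.
move=> gD Lu; rewrite /weighted_dot fineK; last first.
  under eq_integral do rewrite re_dotuu.
  exact: weighted_norm2_fin.
by apply: eq_integral => z _; rewrite re_dotuu.
Qed.

Lemma abs_re_dot u v z : 
  `|re_dot u v z| <= 2^-1 * (Normc.normc (u z) ^+ 2 + Normc.normc (v z) ^+ 2).
Proof.
rewrite !normc2E /re_dot ler_norml; apply/andP; split; rewrite -subr_ge0.
  rewrite (_ : _ - _ = 2^-1 * ((complex.Re (u z) + complex.Re (v z)) ^+ 2 +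
    (complex.Im (u z) + complex.Im (v z)) ^+ 2)); last by field.
  by rewrite mulr_ge0 ?invr_ge0 ?addr_ge0 ?sqr_ge0.
rewrite (_ : _ - _ = 2^-1 * ((complex.Re (u z) - complex.Re (v z)) ^+ 2 +
  (complex.Im (u z) - complex.Im (v z)) ^+ 2)); last by field.
by rewrite mulr_ge0 ?invr_ge0 ?addr_ge0 ?sqr_ge0.
Qed.

Lemma integrable_re_dot h D u v : good D -> L2loc u -> L2loc v ->
  mu.-integrable D (fun z => (re_dot u v z * weight h z)%:E).
Proof.
move=> gD Lu Lv; have mD := good_measurable gD.
apply: (@le_integrable _ _ _ _ _ mD _ (fun z =>
  ((Normc.normc (u z) ^+ 2 * weight h z)%:E +
  (Normc.normc (v z) ^+ 2 * weight h z)%:E)%E)).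
- apply/measurable_EFinP; apply: (measurable_good oOmega gD).
  by apply: measurable_funM; [exact: measurable_re_dot|exact: measurable_weight].
- move=> z Dz; rewrite -EFinD !abse_EFin lee_fin -mulrDl !normrM.
  rewrite ler_wpM2r // (le_trans (abs_re_dot u v z)) // ger0_norm; last first.
    by rewrite addr_ge0 ?sqr_ge0.
  by rewrite ler_piMl ?addr_ge0 ?sqr_ge0 // invf_le1 // ler1n.
- by apply: integrableD => //; exact: integrable_normc2_weight.
Qed.

Lemma weighted_dotC h D u v : wdot h D u v = wdot h D v u.
Proof. by apply: eq_Rintegral => z _; rewrite re_dotC. Qed.

Lemma weighted_dotBl h D u1 u2 v : good D -> L2loc u1 -> L2loc u2 -> L2loc v ->
  wdot h D (fun z => u1 z - u2 z) v = wdot h D u1 v - wdot h D u2 v.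
Proof.
move=> gD L1 L2 Lv; rewrite /weighted_dot -RintegralB.
- apply: eq_Rintegral => z _; rewrite /re_dot !raddfB /=; ring.
- exact: good_measurable gD.
- exact: integrable_re_dot.
- exact: integrable_re_dot.
Qed.

Lemma weighted_dotBr h D u v1 v2 : good D -> L2loc u -> L2loc v1 -> L2loc v2 ->
  wdot h D u (fun z => v1 z - v2 z) = wdot h D u v1 - wdot h D u v2.
Proof.
by move=> gD Lu L1 L2; rewrite weighted_dotC weighted_dotBl // !(weighted_dotC _ _ u).
Qed.

(** The integrated form of 2 a c <= t a^2 + c^2 / t. It stands in for the Cauchy-Schwarz inequality
    and leaves the choice of [t] to the application. *)
Lemma weighted_dot_le h D u v t : good D -> L2loc u -> L2loc v -> 0 < t ->
  wdot h D u v <= 2^-1 * (t * wdot h D u u + t^-1 * wdot h D v v).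
Proof.
move=> gD Lu Lv t0; have mD := good_measurable gD.
have scale c f : mu.-integrable D (fun z => (f z)%:E) ->
    mu.-integrable D (fun z => (c * f z)%:E).
  by move=> fi; rewrite (_ : (fun z => _) = (fun z => (c%:E * (f z)%:E)%E));
    [exact: integrableZl|apply/funext => z].
have duv := integrable_re_dot h gD Lu Lv.
have duu := scale t _ (integrable_re_dot h gD Lu Lu).
have dvv := scale t^-1 _ (integrable_re_dot h gD Lv Lv).
have dsum : mu.-integrable D (fun z => (t * (re_dot u u z * weight h z) +
    t^-1 * (re_dot v v z * weight h z))%:E).
  rewrite (_ : (fun z => _) = (fun z => ((t * (re_dot u u z * weight h z))%:E +
    (t^-1 * (re_dot v v z * weight h z))%:E)%E)).
    exact: integrableD.
  by apply/funext => z.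
rewrite /weighted_dot -!RintegralZl //; try exact: integrable_re_dot.
rewrite -RintegralD // -RintegralZl //.
apply: le_Rintegral => //; first exact: scale.
move=> z Dz; rewrite !mulrA -mulrDl mulrA ler_wpM2r ?weight_ge0 // /re_dot.
set a := complex.Re (u z); set b := complex.Im (u z).
set c := complex.Re (v z); set d := complex.Im (v z).
rewrite -subr_ge0 (_ : _ - _ = (2 * t)^-1 * ((t * a - c) ^+ 2 + (t * b - d) ^+ 2)).
  by rewrite mulr_ge0 ?addr_ge0 ?sqr_ge0 // invr_ge0 mulr_ge0 // ltW.
by field; rewrite gt_eqF.
Qed.

Lemma eq_weighted_dotl h D u u' v : good D -> L2loc u -> L2loc u' -> L2loc v ->
  eq_ae D u u' -> wdot h D u v = wdot h D u' v.
Proof.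
move=> gD Lu Lu' Lv uu'; rewrite /weighted_dot; congr fine.
apply: ae_eq_integral; [exact: good_measurable gD| | |].
- by case/integrableP: (integrable_re_dot h gD Lu Lv).
- by case/integrableP: (integrable_re_dot h gD Lu' Lv).
- by apply: filterS uu' => z /= uz Dz; rewrite /re_dot uz.
Qed.

Lemma eq_weighted_norm2 h D u u' : good D -> L2loc u -> L2loc u' ->
  eq_ae D u u' -> wn2 h D u = wn2 h D u'.
Proof.
move=> gD Lu Lu' uu'; apply: ae_eq_integral; [exact: good_measurable gD| | |].
- exact: measurable_normc2_weight.
- exact: measurable_normc2_weight.
- by apply: filterS uu' => z /= uz Dz; rewrite uz.
Qed.

Lemma weighted_norm2_eq0 h D u : good D -> L2loc u -> wn2 h D u = 0%E ->
  eq_ae D u (fun=> 0).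
Proof.
move=> gD Lu u0; have mD := good_measurable gD.
have : ae_eq mu D (fun z => (Normc.normc (u z) ^+ 2 * weight h z)%:E) (cst 0%E).
  apply/(ae_eq_integral_abs mu mD); first exact: measurable_normc2_weight.
  rewrite -[RHS]u0; apply: eq_integral => z _.
  by rewrite gee0_abs ?normc2_weight_ge0.
apply: filterS => z /= uz Dz; have [/eqP] := uz Dz.
rewrite mulf_eq0 (gt_eqF (weight_gt0 _ _ _)) orbF sqrf_eq0 => /eqP.
exact: Normc.eq0_normc.
Qed.

Lemma weighted_norm2S h D D' u : measurable D -> good D' -> L2loc u ->
  D `<=` D' -> (wn2 h D u <= wn2 h D' u)%E.
Proof.
move=> mD gD' Lu DD'; apply: ge0_subset_integral => //.
- exact: good_measurable gD'.
- exact: measurable_normc2_weight.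
- by move=> z _; exact: normc2_weight_ge0.
Qed.

Lemma weighted_norm2U h D D' u : good D -> good D' -> L2loc u ->
  (wn2 h (D `|` D') u <= wn2 h D u + wn2 h D' u)%E.
Proof.
move=> gD gD' Lu.
have mD := good_measurable gD; have mD' := good_measurable gD'.
have gU := goodU gD gD'.
(* The union is made disjoint, so that the integral splits exactly. *)
have -> : D `|` D' = D `|` (D' `\` D).
  by apply/seteqP; split => z /=; have [] := pselect (D z); tauto.
rewrite /weighted_norm2 ge0_integral_setU //.
- by rewrite leeD2l //; apply: (weighted_norm2S h _ gD' Lu (@subDsetl _ _ _)); exact: measurableD.
- exact: measurableD.
- apply: (@measurable_normc2_weight h) => //; apply: goodU => //; exact: goodD.
- by move=> z _; exact: normc2_weight_ge0.
- by apply/disj_setPS => z [] Dz [].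
Qed.

Lemma weighted_norm2_lin h D (a : R[i]) u v : good D -> L2loc u -> L2loc v ->
  (wn2 h D (fun z => a * u z + v z)%R <=
    (2 * Normc.normc a ^+ 2)%:E * wn2 h D u + 2%:E * wn2 h D v)%E.
Proof.
move=> gD Lu Lv; have mD := good_measurable gD.
have Zl (k : R) w : 0 <= k -> L2loc w -> (k%:E * wn2 h D w =
    \int[mu]_(z in D) (k%:E * (Normc.normc (w z) ^+ 2 * weight h z)%:E))%E.
  move=> k0 Lw; rewrite ge0_integralZl // ?lee_fin //.
    exact: measurable_normc2_weight.
  by move=> z _; exact: normc2_weight_ge0.
have a0 : 0 <= 2 * Normc.normc a ^+ 2 by rewrite mulr_ge0 ?sqr_ge0.
rewrite (Zl _ _ a0 Lu) (Zl _ _ _ Lv) //.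
rewrite -ge0_integralD //; last 4 first.
- by move=> z _; rewrite mule_ge0 ?normc2_weight_ge0 // lee_fin mulr_ge0 ?sqr_ge0.
- by apply: measurable_funeM; exact: measurable_normc2_weight.
- by move=> z _; rewrite mule_ge0 ?normc2_weight_ge0.
- by apply: measurable_funeM; exact: measurable_normc2_weight.
apply: ge0_le_integral => //.
- by move=> z _; exact: (normc2_weight_ge0 h (fun z => a * u z + v z) z).
- exact: (measurable_normc2_weight h gD (L2loc_lin oOmega a Lu Lv)).
- apply: emeasurable_funD; apply: measurable_funeM; exact: measurable_normc2_weight.
- move=> z Dz; rewrite -!EFinM -EFinD lee_fin.
  apply: le_trans (ler_wpM2r (weight_ge0 Phi h z) (sqr_normc_lin a (u z) (v z))) _.
  by rewrite mulrDl !mulrA.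
Qed.

Lemma weighted_dot_cutl h D E u v : D `<=` E ->
  wdot h E (cut D u) v = wdot h D u v.
Proof.
move=> DE; have DED : E `&` D = D by apply/setIidPr.
rewrite /weighted_dot -[in RHS]DED Rintegral_mkcondr.
apply: eq_Rintegral => z _; rewrite patchE /re_dot /cut.
by case: ifP => // _; rewrite /= !mul0r addr0 mul0r.
Qed.

End weighted_norm_theory.

(** * Exponentially small families *)

Section operator_families.
Context {R : realType} {m : nat}.
Variables (Omega : set 'rV[R]_m) (Phi : 'rV[R]_m -> R) (h0 : R).
Hypothesis oOmega : open Omega.
Hypothesis cPhi : {within Omega, continuous Phi}.

Let mu := lebesgue_rV m : {sigma_finite_measure set 'rV[R]_m -> \bar R}.
Local Notation fn := ('rV[R]_m -> R[i]).
Local Notation family := (R -> fn -> fn).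
Local Notation good := (good Omega).
Local Notation wn2 := (weighted_norm2 Phi).
Local Notation wdot := (weighted_dot Phi).
Local Notation L2loc := (L2loc Omega).
Implicit Types (D E F : set 'rV[R]_m) (u v : fn) (h s : R).
Implicit Types (T S A B : family).

Definition preserves_L2loc T :=
  forall h u, 0 < h <= h0 -> L2loc u -> L2loc (T h u).

(* A gain of [exp (- s / h)] on norms, the seminorms being squared here. *)
Definition decay s D T := exists E (C : R), [/\ good E, 0 < C &
  forall h u, 0 < h <= h0 -> L2loc u ->
    (wn2 h D (T h u) <= (C * expR (- 2 * s / h))%:E * wn2 h E u)%E].

(** Rate zero leaves the factor 1, that is, a plain O(1) estimate with the same weight on both
    sides. *)
Definition bounded_family T := forall D, good D -> decay 0 D T.

Definition exp_small T := forall D, good D -> exists2 s, 0 < s & decay s D T.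

Definition linear_family T := forall h (a : R[i]) u v, 0 < h <= h0 ->
  L2loc u -> L2loc v ->
  eq_ae Omega (T h (fun x => a * u x + v x)) (fun x => a * T h u x + T h v x).

Definition comp_family T S : family := fun h u => T h (S h u).

Definition diff_family T S : family := fun h u z => T h u z - S h u z.

(* [B] is the adjoint of [A] for the real part of the inner product; the cuts
   keep all integrals over relatively compact sets. *)
Definition adjoint_families A B := forall h D E u v, 0 < h <= h0 ->
  good D -> good E -> L2loc u -> L2loc v ->
  wdot h E (A h (cut D u)) v = wdot h D u (B h (cut E v)).

Lemma eq_aeS D E u v : D `<=` E -> eq_ae E u v -> eq_ae D u v.
Proof. by move=> DE; apply: filterS => z /= uv /DE. Qed.

Lemma preserves_comp T S : preserves_L2loc T -> preserves_L2loc S ->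
  preserves_L2loc (comp_family T S).
Proof. by move=> pT pS h u hh Lu; apply: pT => //; exact: pS. Qed.

Lemma preserves_diff T S : preserves_L2loc T -> preserves_L2loc S ->
  preserves_L2loc (diff_family T S).
Proof. by move=> pT pS h u hh Lu; apply: L2locB => //; [exact: pT|exact: pS]. Qed.

Lemma weighted_norm2_eq0_ae h D u : good D -> L2loc u -> eq_ae D u (fun=> 0) ->
  wn2 h D u = 0%E.
Proof.
move=> gD Lu u0.
rewrite (eq_weighted_norm2 oOmega cPhi h gD Lu (L2loc0 oOmega) u0).
rewrite /weighted_norm2 -[RHS](integral0 mu D); apply: eq_integral => z _.
by rewrite normc2E /= expr0n addr0 mul0r.
Qed.

Lemma decay_le s t D T : t <= s -> decay s D T -> decay t D T.
Proof.
move=> ts [E [C [gE C0 EC]]]; exists E, C; split => // h u hh Lu.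
apply: le_trans (EC h u hh Lu) _; rewrite lee_wpmul2r ?weighted_norm2_ge0 //.
have [h_gt0 _] := andP hh.
rewrite lee_fin ler_wpM2l ?(ltW C0) // ler_expR ler_pM2r ?invr_gt0 //.
by rewrite !mulNr lerN2 ler_wpM2l.
Qed.

Lemma exp_small_bounded T : exp_small T -> bounded_family T.
Proof. by move=> eT D /eT[s s0]; apply: decay_le; exact: ltW. Qed.

(** The gains multiply. The rate [t] of [S] is asked on every good set, because the set on which [S]
    is estimated comes from [T]. *)
Lemma decay_comp s t D T S : good D -> preserves_L2loc S -> decay s D T ->
  (forall E, good E -> decay t E S) -> decay (s + t) D (comp_family T S).
Proof.
move=> gD pS [E [C [gE C0 EC]]] /(_ E gE)[F [C' [gF C'0 FC]]].
exists F, (C * C'); split => //; first exact: mulr_gt0.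
move=> h u hh Lu; apply: le_trans (EC h _ hh (pS h u hh Lu)) _.
apply: le_trans (lee_wpmul2l _ (FC h u hh Lu)) _.
  by rewrite lee_fin mulr_ge0 ?expR_ge0 ?ltW.
by rewrite muleA -EFinM mulrACA -expRD -mulrDl -mulrDr.
Qed.

Lemma exp_small_compl T S : preserves_L2loc S -> exp_small T ->
  bounded_family S -> exp_small (comp_family T S).
Proof.
move=> pS eT bS D gD; have [s s0 dT] := eT D gD; exists s => //.
by rewrite -[s]addr0; exact: decay_comp.
Qed.

(** Here the rate of [S] depends on the set [E] that the bound of [T] on [D] provides, so that bound
    is opened first and [decay_comp] does not apply. *)
Lemma exp_small_compr T S : preserves_L2loc S -> bounded_family T ->
  exp_small S -> exp_small (comp_family T S).
Proof.
move=> pS bT eS D gD; have [E [C [gE C0 EC]]] := bT D gD.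
have [s s0 [F [C' [gF C'0 FC]]]] := eS E gE.
exists s => //; exists F, (C * C'); split => //; first exact: mulr_gt0.
move=> h u hh Lu; apply: le_trans (EC h _ hh (pS h u hh Lu)) _.
rewrite mulr0 mul0r expR0 mulr1.
apply: le_trans (lee_wpmul2l _ (FC h u hh Lu)) _; first by rewrite lee_fin ltW.
by rewrite muleA -EFinM mulrA.
Qed.

Lemma decay_diff s D T S : good D -> preserves_L2loc T -> preserves_L2loc S ->
  decay s D T -> decay s D S -> decay s D (diff_family T S).
Proof.
move=> gD pT pS [E [C [gE C0 EC]]] [F [C' [gF C'0 FC]]].
(* The factors 2 come from bounding the squared modulus of a difference by twice the sum of the
   squared moduli. *)
exists (E `|` F), (2 * C + 2 * C'); split; first exact: goodU.
  by rewrite addr_gt0 // mulr_gt0.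
move=> h u hh Lu; have LT := pT h u hh Lu; have LS := pS h u hh Lu.
set e := expR _; have e0 : 0 <= e by exact: expR_ge0.
have gU := goodU gE gF.
have lE : (wn2 h E u <= wn2 h (E `|` F) u)%E.
  by apply: (weighted_norm2S oOmega cPhi h _ gU Lu); [exact: gE.1|exact: subsetUl].
have lF : (wn2 h F u <= wn2 h (E `|` F) u)%E.
  by apply: (weighted_norm2S oOmega cPhi h _ gU Lu); [exact: gF.1|exact: subsetUr].
rewrite (_ : diff_family T S h u = (fun z => -1 * S h u z + T h u z)); last first.
  by apply/funext => z; rewrite /diff_family mulN1r addrC.
apply: le_trans (weighted_norm2_lin oOmega cPhi h (-1) gD LS LT) _.
rewrite (_ : Normc.normc (-1) = 1); last first.
  by rewrite /= oppr0 sqrrN expr1n expr0n addr0 sqrtr1.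
set a := wn2 h (E `|` F) u.
have -> : (((2 * C + 2 * C') * e)%:E * a =
    2%:E * ((C' * e)%:E * a) + 2%:E * ((C * e)%:E * a))%E.
  have p1 : 0 <= 2 * (C' * e) by rewrite !mulr_ge0 // ltW.
  have p2 : 0 <= 2 * (C * e) by rewrite !mulr_ge0 // ltW.
  rewrite !muleA -!EFinM -ge0_muleDl ?lee_fin //.
  by congr (_%:E * _)%E; ring.
rewrite expr1n mulr1; apply: leeD; apply: lee_wpmul2l => //.
- apply: le_trans (FC h u hh Lu) _; apply: lee_wpmul2l => //.
  by rewrite lee_fin mulr_ge0 // ltW.
- apply: le_trans (EC h u hh Lu) _; apply: lee_wpmul2l => //.
  by rewrite lee_fin mulr_ge0 // ltW.
Qed.

Lemma bounded_diff T S : preserves_L2loc T -> preserves_L2loc S ->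
  bounded_family T -> bounded_family S -> bounded_family (diff_family T S).
Proof. by move=> pT pS bT bS D gD; apply: decay_diff => //; [exact: bT|exact: bS]. Qed.

Lemma exp_small_diff T S : preserves_L2loc T -> preserves_L2loc S ->
  exp_small T -> exp_small S -> exp_small (diff_family T S).
Proof.
move=> pT pS eT eS D gD; have [s s0 dT] := eT D gD; have [t t0 dS] := eS D gD.
exists (Num.min s t); first by rewrite lt_min s0.
by apply: decay_diff => //; [apply: decay_le dT|apply: decay_le dS];
  rewrite ge_min lexx ?orbT.
Qed.

(** Linearity, and hence every operator identity deduced from it, holds only almost everywhere; this
    transports smallness along such an identity. *)
Lemma exp_small_ae T S : preserves_L2loc T -> preserves_L2loc S ->
  (forall h u, 0 < h <= h0 -> L2loc u -> eq_ae Omega (T h u) (S h u)) ->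
  exp_small S -> exp_small T.
Proof.
move=> pT pS TS eS D gD; have [s s0 [E [C [gE C0 EC]]]] := eS D gD.
exists s => //; exists E, C; split => // h u hh Lu.
rewrite (eq_weighted_norm2 oOmega cPhi h gD (pT h u hh Lu) (pS h u hh Lu)).
  exact: EC.
apply: eq_aeS (TS h u hh Lu); exact: good_sub.
Qed.

(** * Locality of bounded families *)

Definition null_on T D E := forall h u, 0 < h <= h0 -> L2loc u ->
  eq_ae E u (fun=> 0) -> eq_ae D (T h u) (fun=> 0).

Definition local_on T D E := forall h u v, 0 < h <= h0 -> L2loc u -> L2loc v ->
  eq_ae E u v -> eq_ae D (T h u) (T h v).

(** If [u] vanishes on [E], the right-hand side of the seminorm estimate is zero, and the weight is
    positive. *)
Lemma bounded_null T D : preserves_L2loc T -> bounded_family T -> good D ->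
  exists2 E, good E & null_on T D E.
Proof.
move=> pT bT gD; have [E [C [gE C0 EC]]] := bT D gD; exists E => // h u hh Lu u0.
apply: (weighted_norm2_eq0 oOmega cPhi gD (pT h u hh Lu)).
apply/eqP; rewrite eq_le weighted_norm2_ge0 andbT.
apply: le_trans (EC h u hh Lu) _.
by rewrite (weighted_norm2_eq0_ae h gE Lu u0) mule0.
Qed.

Lemma null_local T D E : good D -> linear_family T -> null_on T D E ->
  local_on T D E.
Proof.
move=> gD lT nT h u v hh Lu Lv uv.
(* The vanishing property is applied to the difference of the two functions. *)
have nul : eq_ae D (T h (fun x => -1 * v x + u x)) (fun=> 0).
  apply: nT => //; first exact: L2loc_lin.
  by apply: filterS uv => z /= uv Ez; rewrite uv // mulN1r addNr.
have lin := eq_aeS (good_sub gD) (lT h (-1) v u hh Lv Lu).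
apply: filterS2 nul lin => z /= nul lin Dz.
by apply/eqP; rewrite -subr_eq0 addrC -mulN1r -lin // nul.
Qed.

Definition local_family T :=
  forall D, good D -> exists2 E, good E & local_on T D E.

Lemma bounded_local T : preserves_L2loc T -> linear_family T ->
  bounded_family T -> local_family T.
Proof.
move=> pT lT bT D gD; have [E gE nT] := bounded_null pT bT gD.
by exists E => //; exact: null_local.
Qed.

Lemma local_comp T S : preserves_L2loc S -> local_family T -> local_family S ->
  local_family (comp_family T S).
Proof.
move=> pS lT lS D gD; have [E gE TE] := lT D gD; have [F gF SF] := lS E gE.
exists F => // h u v hh Lu Lv uv; apply: TE => //; [exact: pS..|exact: SF].
Qed.

Lemma local_diff T S : local_family T -> local_family S ->
  local_family (diff_family T S).
Proof.
move=> lT lS D gD; have [E gE TE] := lT D gD; have [F gF SF] := lS D gD.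
exists (E `|` F); first exact: goodU.
move=> h u v hh Lu Lv uv.
have Tuv := TE h u v hh Lu Lv (eq_aeS (@subsetUl _ E F) uv).
have Suv := SF h u v hh Lu Lv (eq_aeS (@subsetUr _ E F) uv).
by apply: filterS2 Tuv Suv => z /= Tz Sz Dz; rewrite /diff_family Tz ?Sz.
Qed.

(** * Adjoints and the transfer of smallness by duality *)

Lemma adjoint_diff A B A' B' : preserves_L2loc A -> preserves_L2loc A' ->
  preserves_L2loc B -> preserves_L2loc B' ->
  adjoint_families A B -> adjoint_families A' B' ->
  adjoint_families (diff_family A A') (diff_family B B').
Proof.
move=> pA pA' pB pB' AB AB' h D E u v hh gD gE Lu Lv.
have LDu := L2loc_cut oOmega (good_measurable gD) Lu.
have LEv := L2loc_cut oOmega (good_measurable gE) Lv.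
rewrite (weighted_dotBl oOmega cPhi h gE (pA _ _ hh LDu) (pA' _ _ hh LDu) Lv).
rewrite (weighted_dotBr oOmega cPhi h gD Lu (pB _ _ hh LEv) (pB' _ _ hh LEv)).
by rewrite AB // AB'.
Qed.

(* Pairing [B (cut D v)], restricted to [F \ E], with itself gives the pairing of
   [v] with a function that [A] maps to zero on [D]. *)
Lemma adjoint_vanish A B D E F h v : preserves_L2loc A -> preserves_L2loc B ->
  adjoint_families A B -> null_on A D E -> good D -> good E -> good F ->
  0 < h <= h0 -> L2loc v -> eq_ae (F `\` E) (B h (cut D v)) (fun=> 0).
Proof.
move=> pA pB AB nA gD gE gF hh Lv; set f := B h (cut D v).
have gFE : good (F `\` E) by exact: goodD.
have Lf : L2loc f by apply: pB => //; exact: L2loc_cut (good_measurable gD) Lv.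
have Lcf := L2loc_cut oOmega (good_measurable gFE) Lf.
apply: (weighted_norm2_eq0 oOmega cPhi gFE Lf (h := h)).
rewrite (weighted_norm2_dot oOmega cPhi h gFE Lf) -AB //.
rewrite (eq_weighted_dotl oOmega cPhi h gD (pA _ _ hh Lcf) (L2loc0 oOmega) Lv).
  congr EFin; rewrite -(mul0r (fine (mu D))) -(Rintegral_cst mu (good_measurable gD)).
  by apply: eq_Rintegral => z _; rewrite /re_dot /= !mul0r addr0 mul0r.
apply: nA => //; apply: aeW => z Ez; rewrite cut_out // => -[_]; exact.
Qed.

(** The adjoint identity of [A] and [B] takes only truncated functions, whereas [A' (cut D u)] is
    not truncated. A cut to [F] is inserted on the way in, where [A] does not see it, and removed on
    the way out, where [B (cut E v)] vanishes outside [F]. *)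
Lemma adjoint_comp A B A' B' :
  preserves_L2loc A -> preserves_L2loc B ->
  preserves_L2loc A' -> preserves_L2loc B' ->
  linear_family A -> linear_family B' -> bounded_family A -> bounded_family B' ->
  adjoint_families A B -> adjoint_families A' B' ->
  adjoint_families (comp_family A A') (comp_family B' B).
Proof.
move=> pA pB pA' pB' lA lB' bA bB' AB AB' h D E u v hh gD gE Lu Lv.
(* On [E], the values of [A] depend only on its argument on [F]; on [D], the values of [B'] depend
   only on its argument on [G]. *)
have [F gF nA] := bounded_null pA bA gE.
have [G gG lcB'] := bounded_local pB' lB' bB' gD.
have LDu := L2loc_cut oOmega (good_measurable gD) Lu.
have LEv := L2loc_cut oOmega (good_measurable gE) Lv.
have LA' := pA' _ _ hh LDu; have LB := pB _ _ hh LEv.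
have LcA' := L2loc_cut oOmega (good_measurable gF) LA'.
have LcB := L2loc_cut oOmega (good_measurable gF) LB.
rewrite /comp_family.
rewrite (eq_weighted_dotl oOmega cPhi h gE (pA _ _ hh LA') (pA _ _ hh LcA') Lv).
  rewrite AB // AB' // !(weighted_dotC _ _ _ u).
  apply: (eq_weighted_dotl oOmega cPhi h gD (pB' _ _ hh LcB) (pB' _ _ hh LB) Lu).
  apply: lcB' => //.
  (* On [G] the cut to [F] changes nothing: the function already vanishes on [G] outside [F]. *)
  have := adjoint_vanish pA pB AB nA gE gF gG hh Lv.
  apply: filterS => z /= vz Gz; have [Fz|Fz] := pselect (F z).
    by rewrite cut_in.
  by rewrite cut_out // vz.
have lcA := null_local gE lA nA.
by apply: lcA => //; apply: aeW => z Fz; rewrite cut_in.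
Qed.

Lemma weighted_norm2_cut h D E u : good D -> good E -> L2loc u ->
  (wn2 h E (cut D u) <= wn2 h D u)%E.
Proof.
move=> gD gE Lu; have mD := good_measurable gD; have mE := good_measurable gE.
have := weighted_norm2S oOmega cPhi h (measurableI _ _ mE mD) gD Lu (@subIsetr _ _ _).
apply: le_trans; rewrite /weighted_norm2 integral_mkcondr.
rewrite le_eqVlt; apply/orP; left; apply/eqP; apply: eq_integral => z _.
rewrite patchE /cut; case: ifP => // _.
by rewrite normc2E /= expr0n addr0 mul0r.
Qed.

(** The squared norm of [T h u] over [D] is the pairing of [u] with [S] applied to the truncated
    [T h u]. The smallness of [S] on the set [E] of locality then passes to [T] with the same rate
    and the same constant. *)
Lemma adjoint_exp_small T S : preserves_L2loc T -> preserves_L2loc S ->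
  local_family T -> adjoint_families T S -> exp_small S -> exp_small T.
Proof.
move=> pT pS lT TS eS D gD; have [E gE lc] := lT D gD.
have [s s0 [F [C [gF C0 FC]]]] := eS E gE; exists s => //.
exists E, C; split => // h u hh Lu.
set c := C * _; have c0 : 0 < c by rewrite mulr_gt0 ?expR_gt0.
have LT := pT _ _ hh Lu.
have LcT := L2loc_cut oOmega (good_measurable gD) LT.
have LS := pS _ _ hh LcT.
have Lcu := L2loc_cut oOmega (good_measurable gE) Lu.
(* By locality [u] may be replaced by [cut E u], to which the adjoint identity applies. *)
have dotT : wdot h D (T h u) (T h u) = wdot h E u (S h (cut D (T h u))).
  rewrite -TS //.
  apply: (eq_weighted_dotl oOmega cPhi h gD LT (pT _ _ hh Lcu) LT).
  by apply: lc => //; apply: aeW => z Ez; rewrite cut_in.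
(* The estimate of [S] involves a norm over [F]; since the argument is cut to [D], that norm is at
   most the one over [D]. *)
have dotS : wdot h E (S h (cut D (T h u))) (S h (cut D (T h u))) <=
    c * wdot h D (T h u) (T h u).
  rewrite -lee_fin EFinM -!(weighted_norm2_dot oOmega cPhi) //.
  apply: le_trans (FC h _ hh LcT) _; apply: lee_wpmul2l.
    by rewrite lee_fin ltW.
  exact: weighted_norm2_cut.
rewrite !(weighted_norm2_dot oOmega cPhi) // -EFinM lee_fin.
(* AM-GM with parameter [c] leaves half of the norm of [T h u], which is
   absorbed on the left. *)
have := weighted_dot_le oOmega cPhi h gE Lu LS c0; rewrite -dotT.
have : c^-1 * wdot h E (S h (cut D (T h u))) (S h (cut D (T h u))) <=
    wdot h D (T h u) (T h u) by rewrite ler_pdivrMl.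
lra.
Qed.

End operator_families.

(** * Square roots, relatively compact balls and change of weight *)

Lemma poweR_half_le (R : realType) (C : R) (x y : \bar R) : 0 <= C ->
  (0 <= x -> 0 <= y ->
   (x `^ 2^-1 <= C%:E * y `^ 2^-1) = (x <= (C ^+ 2)%:E * y))%E.
Proof.
move=> C0 x0 y0; have C20 : (0 <= (C ^+ 2)%:E)%E by rewrite lee_fin sqr_ge0.
rewrite (_ : C%:E = (C ^+ 2)%:E `^ 2^-1)%E; last first.
  by rewrite poweR_EFin powR12_sqrt ?sqr_ge0 // sqrtr_sqr ger0_norm.
rewrite -poweRM // !poweR12_sqrt ?mule_ge0 // lee_sqrt ?mule_ge0 //.
Qed.

Section shrinking.
Context {R : realType} {m : nat}.
Implicit Types (x y z : 'rV[R]_m) (Omega : set 'rV[R]_m).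

Lemma closure_ballS x (r : R) : closure (ball x r) `<=` ball x (r + r).
Proof.
move=> y xy; have [r0|r0] := ltP 0 r; last first.
  by have [z [[/=]]] := xy setT filterT; rewrite ltNge r0.
have [z [xz yz]] := xy _ (nbhsx_ballx y _ r0).
by apply: ball_triangle xz _; exact: ball_sym.
Qed.

Lemma rel_compact_ball Omega x (r : R) : ball x (r + r) `<=` Omega ->
  rel_compact (ball x r) Omega.
Proof.
move=> xO; split; last by move=> y /closure_ballS; exact: xO.
apply: bounded_closed_compact; last exact: closed_closure.
exists (`|x| + (r + r)); split; first exact: num_real.
move=> M ltM y /closure_ballS; rewrite -ball_normE /= => xy.
apply: le_trans (ltW ltM); rewrite -[y](subrK x) addrC.
by rewrite (le_trans (ler_normD _ _)) // lerD2l distrC ltW.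
Qed.

(** The continuous function g - f has a positive minimum on the compact closure of [D]. This is
    where the exponential rates come from. *)
Lemma good_gap Omega (f g : 'rV[R]_m -> R) D : good Omega D ->
  {within Omega, continuous f} -> {within Omega, continuous g} ->
  (forall z, Omega z -> f z < g z) ->
  exists2 s, 0 < s & forall z, D z -> f z + s <= g z.
Proof.
move=> [_ [cD DO]] cf cg fg.
have [nD|nD] := pselect (closure D !=set0); last first.
  by exists 1 => // z Dz; case: nD; exists z; exact: subset_closure.
have cfg : {within Omega, continuous (fun z => f z - g z)}.
  by move=> z; apply: continuousB; [exact: cf|exact: cg].
have [c cD' cM] := compact_EVT_max nD cD (continuous_subspaceW DO cfg).
have Oc : Omega c by apply: DO; rewrite inE in cD'.
exists (g c - f c); first by rewrite subr_gt0 fg.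
move=> z Dz; have : f z - g z <= f c - g c.
  by apply: cM; rewrite inE; exact: subset_closure.
lra.
Qed.

(** The comparison of the weights is pointwise. The number [s] may be negative, and the inequality
    then bounds the loss in passing to a smaller weight function. *)
Lemma weighted_norm2_shift Omega (Phi Psi : 'rV[R]_m -> R) h s D u :
  open Omega -> {within Omega, continuous Phi} -> {within Omega, continuous Psi} ->
  good Omega D -> L2loc Omega u -> 0 < h ->
  (forall z, D z -> Psi z + s <= Phi z) ->
  (weighted_norm2 Phi h D u <=
   (expR (- 2 * s / h))%:E * weighted_norm2 Psi h D u)%E.
Proof.
move=> oO cPhi cPsi gD Lu h0 sD.
rewrite /weighted_norm2 -ge0_integralZl ?lee_fin ?expR_ge0 //.
- apply: ge0_le_integral => //.
  + exact: good_measurable gD.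
  + by move=> z _; exact: normc2_weight_ge0.
  + exact: (measurable_normc2_weight oO cPhi).
  + by apply: measurable_funeM; exact: (measurable_normc2_weight oO cPsi).
  + move=> z Dz; rewrite -EFinM lee_fin mulrCA ler_wpM2l ?sqr_ge0 //.
    rewrite /weight -expRD ler_expR -mulrDl ler_pM2r ?invr_gt0 //.
    have := sD z Dz; lra.
- exact: good_measurable gD.
- exact: (measurable_normc2_weight oO cPsi).
- by move=> z _; exact: normc2_weight_ge0.
Qed.

End shrinking.

(** * A lower weight for an exponentially small family *)

Section lower_weight.
Context {R : realType} {m : nat}.
Variables (Omega : set 'rV[R]_m) (Phi : 'rV[R]_m -> R) (h0 : R).
Hypothesis oOmega : open Omega.
Hypothesis cPhi : {within Omega, continuous Phi}.
Variable T : R -> ('rV[R]_m -> R[i]) -> 'rV[R]_m -> R[i].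
Hypothesis pT : preserves_L2loc Omega h0 T.
Hypothesis eT : exp_small Omega Phi h0 T.
Implicit Types (x y z : 'rV[R]_m) (D : set 'rV[R]_m).
Local Notation good := (good Omega).
Local Notation decay := (decay Omega Phi h0).

Lemma decay_sub s D D' : measurable D -> D `<=` D' -> good D' ->
  decay s D' T -> decay s D T.
Proof.
move=> mD DD' gD' [E [C [gE C0 EC]]]; exists E, C; split => // h u hh Lu.
apply: le_trans (EC h u hh Lu).
exact: (weighted_norm2S oOmega cPhi h mD gD' (pT hh Lu) DD').
Qed.

(* As a rate [s] is required on the ball of the same radius [s], the supremum of
   the rates at a point is a 1-Lipschitz function of this point. *)
Definition decay_rates z : set R :=
  [set s | [/\ 0 < s <= 1, good (ball z s) & decay s (ball z s) T]].

Lemma decay_rates_sub z s z' s' : 0 < s' <= s -> ball z' s' `<=` ball z s ->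
  decay_rates z s -> decay_rates z' s'.
Proof.
move=> /andP[s'0 s's] sub [/andP[s0 s1] gs ds].
have mb : measurable (ball z' s') by exact: measurable_cube.
split; first by rewrite s'0 (le_trans s's).
  exact: good_subset gs.
exact: (decay_le s's (decay_sub mb sub gs ds)).
Qed.

Lemma decay_rates_neq0 z : Omega z -> exists s, decay_rates z s.
Proof.
move=> Oz; have /nbhs_ballP[r /= r0 rO] : nbhs z Omega by move: oOmega; rewrite openE; exact.
have gr : good (ball z (r / 2)).
  split; first exact: measurable_cube.
  by apply: rel_compact_ball; rewrite -splitr.
(* One number has to serve as rate and as radius: at most the rate [s] available on the ball, at
   most 1, and small enough for the ball to be good. *)
have [s s0 ds] := eT gr; pose t := Num.min (Num.min s 1) (r / 2).
have t0 : 0 < t by rewrite !lt_min s0 ltr01 divr_gt0.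
have tb : ball z t `<=` ball z (r / 2).
  by apply: le_ball; rewrite /t ge_min lexx orbT.
have mt : measurable (ball z t) by exact: measurable_cube.
exists t; split.
- by rewrite t0 /t !ge_min lexx !orbT.
- exact: good_subset gr.
- have ts : t <= s by rewrite /t !ge_min lexx.
  exact: (decay_le ts (decay_sub mt tb gr ds)).
Qed.

Definition max_rate z := sup (decay_rates z).

Lemma decay_rates_ubound z : has_ubound (decay_rates z).
Proof. by exists 1 => s [/andP[]]. Qed.

Lemma max_rate_gt0 z : Omega z -> 0 < max_rate z.
Proof.
move=> /decay_rates_neq0[s sz]; have [/andP[s0 _] _ _] := sz.
by apply: lt_le_trans s0 _; exact: (ub_le_sup (decay_rates_ubound z)).
Qed.

(** A rate s > e at [z] yields the rate s - e at [z'], since the ball of radius s - e around [z']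
    lies in the ball of radius s around [z]; a rate s <= e is harmless because [max_rate z'] is
    positive. *)
Lemma max_rate_lipschitz z z' e : Omega z -> Omega z' -> ball z e z' ->
  max_rate z - e <= max_rate z'.
Proof.
move=> Oz Oz' zz'; rewrite lerBlDr; apply: ge_sup; first exact: decay_rates_neq0.
move=> s sz; have [se|se] := leP s e.
  by rewrite (le_trans se) // lerDr ltW // max_rate_gt0.
rewrite -lerBlDr; apply: (ub_le_sup (decay_rates_ubound z')).
apply: decay_rates_sub sz.
  by rewrite subr_gt0 se gerBl (ltW zz'.1).
by move=> y z'y; rewrite -[s](subrKC e); exact: ball_triangle zz' z'y.
Qed.

Lemma continuous_max_rate : {within Omega, continuous max_rate}.
Proof.
rewrite continuous_open_subspace // => z; rewrite inE => Oz.
move=> A /nbhs_ballP[e /= e0 eA].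
have e20 : 0 < e / 2 by rewrite divr_gt0.
have nz : nbhs z (Omega `&` ball z (e / 2)).
  by apply: filterI; [move: oOmega; rewrite openE; exact|exact: nbhsx_ballx].
apply: filterS nz => z' [Oz' zz']; apply: eA.
have l1 := max_rate_lipschitz Oz Oz' zz'.
have l2 := max_rate_lipschitz Oz' Oz (ball_sym zz').
suff : `|max_rate z - max_rate z'| < e by rewrite -ball_normE.
move: (max_rate z) (max_rate z') l1 l2 => a b l1 l2.
by rewrite ltr_distl; lra.
Qed.

(** Half of the best rate leaves room for the variation of [max_rate] on a small ball. *)
Definition lower_weight z := Phi z - max_rate z / 2.

Lemma continuous_lower_weight : {within Omega, continuous lower_weight}.
Proof.
have cm : {within Omega, continuous (fun z => max_rate z / 2)}.
  by move=> z; apply: continuousM; [exact: continuous_max_rate|exact: cst_continuous].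
by move=> z; exact: (continuousB (@cPhi z) (@cm z)).
Qed.

Lemma lower_weight_lt z : Omega z -> lower_weight z < Phi z.
Proof. by move=> /max_rate_gt0 ?; rewrite /lower_weight; lra. Qed.

Definition lower_bounded D := exists E (C : R), [/\ good E, 0 < C &
  forall h u, 0 < h <= h0 -> L2loc Omega u ->
    (weighted_norm2 lower_weight h D (T h u) <=
     C%:E * weighted_norm2 Phi h E u)%E].

Lemma lower_bounded_near z : Omega z ->
  exists2 r, 0 < r & good (ball z r) /\ lower_bounded (ball z r).
Proof.
move=> Oz; have d0 := max_rate_gt0 Oz.
(* With a the best rate at [z], the Lipschitz bound gives [max_rate] <= 3a/2 on a ball of radius at
   most a/2. Half of this is 3a/4, which stays below [s]. *)
have [s sz ls] : exists2 s, decay_rates z s & 3 / 4 * max_rate z < s.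
  have d40 : 0 < max_rate z / 4 by rewrite divr_gt0.
  have [|s sz ls] := sup_adherent d40 (E := decay_rates z).
    by split; [exact: decay_rates_neq0|exact: decay_rates_ubound].
  exists s => //; apply: le_lt_trans ls; rewrite -/(max_rate z).
  by move: (max_rate z) => a; lra.
have [/andP[s0 _] gs [E [C [gE C0 EC]]]] := sz.
pose r := Num.min s (max_rate z / 2).
have r0 : 0 < r by rewrite lt_min s0 divr_gt0.
have rs : ball z r `<=` ball z s by apply: le_ball; rewrite ge_min lexx.
have mr : measurable (ball z r) by exact: measurable_cube.
have gr : good (ball z r) by exact: good_subset gs.
exists r => //; split => //; exists E, C; split => // h u hh Lu.
have /andP[hp _] := hh.
have LT := pT hh Lu.
have gap y : ball z r y -> Phi y + - s <= lower_weight y.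
  move=> zy; have Oy : Omega y by exact: (good_sub gr).
  have l1 := max_rate_lipschitz Oy Oz (ball_sym zy).
  have l2 : r <= max_rate z / 2 by rewrite ge_min lexx orbT.
  rewrite /lower_weight; move: (max_rate z) (max_rate y) (Phi y) ls l1 l2.
  by move: {+}r {+}s => r' s' a b c; lra.
(* The change of weight costs exp(2 s / h), which the decay exp(- 2 s / h) of the squared norm
   compensates exactly. *)
apply: le_trans (weighted_norm2_shift oOmega continuous_lower_weight cPhi gr LT hp gap) _.
have := weighted_norm2S oOmega cPhi h mr gs LT rs.
move=> /le_trans/(_ (EC h u hh Lu)) le1.
apply: le_trans (lee_wpmul2l _ le1) _; first by rewrite lee_fin expR_ge0.
by rewrite muleA -EFinM mulrCA -expRD -mulrDl -mulrDr addNr mulr0 mul0r expR0 mulr1.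
Qed.

Lemma lower_boundedU D D' : good D -> good D' ->
  lower_bounded D -> lower_bounded D' -> lower_bounded (D `|` D').
Proof.
move=> gD gD' [E [C [gE C0 EC]]] [E' [C' [gE' C'0 EC']]].
have gU := goodU gE gE'.
exists (E `|` E'), (C + C'); split => //; first exact: addr_gt0.
move=> h u hh Lu.
apply: le_trans (weighted_norm2U oOmega continuous_lower_weight h gD gD' (pT hh Lu)) _.
have C0' := ltW C0; have C'0' := ltW C'0.
rewrite EFinD ge0_muleDl ?lee_fin //; apply: leeD.
- apply: le_trans (EC h u hh Lu) _; apply: lee_wpmul2l; first by rewrite lee_fin ltW.
  by apply: (weighted_norm2S oOmega cPhi h _ gU Lu); [exact: gE.1|exact: subsetUl].
- apply: le_trans (EC' h u hh Lu) _; apply: lee_wpmul2l; first by rewrite lee_fin ltW.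
  by apply: (weighted_norm2S oOmega cPhi h _ gU Lu); [exact: gE'.1|exact: subsetUr].
Qed.

(** The compact closure of [D] is covered by finitely many balls on which the local estimate holds,
    and finite unions preserve that estimate. *)
Lemma exp_small_lower_bounded D : good D -> lower_bounded D.
Proof.
move=> gD; have [mD [cD DO]] := gD.
have /choice[r rP] z : exists r, closure D z ->
    [/\ 0 < r, good (ball z r) & lower_bounded (ball z r)].
  (* Outside the closure of [D] the radius is a default value. *)
  have [Dz|Dz] := pselect (closure D z); last by exists 0.
  by have [r r0 [gr lr]] := lower_bounded_near (DO z Dz); exists r.
have [s sD Ds] : exists2 s : seq 'rV[R]_m, (forall z, z \in s -> closure D z) &
    closure D `<=` \big[setU/set0]_(z <- s) ball z (r z).
  have := cD; rewrite compact_cover => /(_ _ (closure D) (fun z => ball z (r z))).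
  case=> [z _|z Dz|S SD DS].
  - exact: ball_open.
  - by exists z => //; apply: ballxx; have [] := rP z Dz.
  - exists (finmap.enum_fset S) => [z zS|z /DS[y /= yS zy]].
      by rewrite -inE; apply: SD.
    by rewrite -bigcup_seq; exists y.
have {sD} [gs [E [C [gE C0 EC]]]] : good (\big[setU/set0]_(z <- s) ball z (r z)) /\
    lower_bounded (\big[setU/set0]_(z <- s) ball z (r z)).
  elim: s sD {Ds} => [_|z s IH sD].
    rewrite big_nil; split; first exact: good0.
    exists set0, 1; split => //; first exact: good0.
    by move=> h u _ _; rewrite /weighted_norm2 !integral_set0 mule0.
  have [|gs ls] := IH; first by move=> y ys; apply: sD; rewrite inE ys orbT.
  have [_ gr lr] := rP z (sD z (mem_head _ _)).
  by rewrite big_cons; split; [exact: goodU|exact: lower_boundedU].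
exists E, C; split => // h u hh Lu; apply: le_trans (EC h u hh Lu).
apply: (weighted_norm2S oOmega continuous_lower_weight h mD gs (pT hh Lu)).
by apply: subset_trans Ds; exact: subset_closure.
Qed.

End lower_weight.

Lemma normcB_le (R : realType) (x y : R[i]) :
  Normc.normc (x - y) <= Normc.normc x + Normc.normc y.
Proof. by rewrite -lecR rmorphD /=; exact: (@ler_normB _ R[i]). Qed.

(** * Distribution kernels *)

Section test_functions.
Context {R : realType} {m : nat}.
Variable Omega : set 'rV[R]_m.
Hypothesis oOmega : open Omega.
Implicit Types (u v phi : 'rV[R]_m -> R[i]).

Let mu := lebesgue_rV m : {sigma_finite_measure set 'rV[R]_m -> \bar R}.

Lemma good_finite_measure D : good Omega D -> (mu D < +oo)%E.
Proof.
move=> [mD [cD _]]; have [M [_ MD]] := compact_bounded cD.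
have {}MD y : D y -> `|y| <= `|M| + 1.
  move=> Dy; apply: (MD (`|M| + 1)); last exact: subset_closure.
  by rewrite (le_lt_trans (ler_norm M)) // ltrDl.
apply: le_lt_trans (lebesgue_rV_bounded m (`|M| + 2)).
apply: le_measure; rewrite ?inE //; first exact: measurable_box.
move=> y /MD yM i.
have : ball (0 : 'rV[R]_m) (`|M| + 2) y.
  rewrite -ball_normE /= sub0r normrN (le_lt_trans yM) // ltrD2l; lra.
by move=> [_ /(_ 0 i)]; rewrite /ball /= mxE sub0r normrN => /ltW.
Qed.

Lemma test_function_L2loc phi : test_function Omega phi -> L2loc Omega phi.
Proof.
move=> [/(_ 0)[/(_ [::] isT)[cR _] /(_ [::] isT)[cI _]] _ _].
have {}cR : {within Omega, continuous (fun x => complex.Re (phi x))}.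
  exact: continuous_subspaceW cR.
have {}cI : {within Omega, continuous (fun x => complex.Im (phi x))}.
  exact: continuous_subspaceW cI.
apply: L2locI => //; [exact: continuous_within_measurable..|].
move=> D gD; have mD := good_measurable gD.
have cRR : {within Omega, continuous (fun z => complex.Re (phi z) * complex.Re (phi z))}.
  by move=> z; apply: continuousM; exact: cR.
have cII : {within Omega, continuous (fun z => complex.Im (phi z) * complex.Im (phi z))}.
  by move=> z; apply: continuousM; exact: cI.
have [M MD] := good_bounded_above gD (fun z => continuousD (@cRR z) (@cII z)).
exists (fun=> `|M|); last first.
  by move=> z Dz; rewrite normc2E !expr2 (le_trans (MD z Dz)) // ler_norm.
apply/integrableP; split; first exact: measurable_cst.
under eq_integral do rewrite /= normr_id.
by rewrite integral_cst // lte_mul_pinfty // good_finite_measure.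
Qed.

Lemma good_csupp phi : test_function Omega phi -> good Omega (csupp phi).
Proof.
move=> [_ cphi sO]; split; first by apply: closed_measurable_rV; exact: closed_closure.
have cl : closure (csupp phi) = csupp phi.
  by apply/esym/closure_id; exact: closed_closure.
by rewrite /rel_compact cl.
Qed.

(** On the compact support of [phi] the product is dominated by the sum of the squared moduli;
    elsewhere it is zero. This is applied to the real and imaginary parts of the product. *)
Lemma integrable_mul_test u phi (f : 'rV[R]_m -> R) : L2loc Omega u ->
  test_function Omega phi -> measurable_fun Omega f ->
  (forall z, `|f z| <= Normc.normc (u z * phi z)) ->
  mu.-integrable Omega (EFin \o f).
Proof.
move=> Lu tphi mf fup; have gS := good_csupp tphi; have mS := good_measurable gS.
have mO : measurable Omega by exact: measurable_Omega.
pose g z : \bar R := ((Normc.normc (u z) ^+ 2)%:E + (Normc.normc (phi z) ^+ 2)%:E)%E.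
have ig : mu.-integrable Omega (g \_ (csupp phi)).
  apply: (integrableS measurableT mO (@subsetT _ _)).
  apply/(@integrable_mkcond _ _ _ mu _ g mS).
  apply: integrableD => //; apply: (integrable_normc2 oOmega gS) => //.
  exact: test_function_L2loc.
apply: (le_integrable mO _ _ ig); first exact/measurable_EFinP.
move=> z Oz; rewrite patchE; case: ifPn => [_|]; last first.
  move=> /negP; rewrite inE => Sz; rewrite abse0 lee_fin (le_trans (fup z)) //.
  rewrite (_ : phi z = 0) ?mulr0 ?Normc.normc0 //.
  by apply/eqP; apply: contra_notT Sz => ?; exact: subset_closure.
rewrite /g -EFinD lee_fin (le_trans (fup z)) // Normc.normcM.
rewrite [leRHS]ger0_norm ?addr_ge0 ?sqr_ge0 // -subr_ge0.
set a := Normc.normc _; set b := Normc.normc _.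
rewrite (_ : _ - _ = 2^-1 * ((a - b) ^+ 2 + a ^+ 2 + b ^+ 2)); last by field.
by rewrite mulr_ge0 ?invr_ge0 // !addr_ge0 ?sqr_ge0.
Qed.

Lemma normc_ge_absRe (z : R[i]) : `|complex.Re z| <= Normc.normc z.
Proof. by case: z => a b /=; rewrite -sqrtr_sqr ler_wsqrtr // lerDl sqr_ge0. Qed.

Lemma normc_ge_absIm (z : R[i]) : `|complex.Im z| <= Normc.normc z.
Proof. by case: z => a b /=; rewrite -sqrtr_sqr ler_wsqrtr // lerDr sqr_ge0. Qed.

Lemma cintegralB_test u v phi : L2loc Omega u -> L2loc Omega v ->
  test_function Omega phi ->
  cintegral Omega (fun z => (u z - v z) * phi z) =
  cintegral Omega (fun z => u z * phi z) - cintegral Omega (fun z => v z * phi z).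
Proof.
move=> Lu Lv tphi; have mO : measurable Omega by exact: measurable_Omega.
have [mRp mIp _] := test_function_L2loc tphi.
have iR w : L2loc Omega w ->
    mu.-integrable Omega (EFin \o (fun z => complex.Re (w z * phi z))).
  move=> Lw; have [mR mI _] := Lw; apply: (integrable_mul_test Lw tphi) => [|z].
    rewrite (_ : (fun z => _) = (fun z => complex.Re (w z) * complex.Re (phi z) -
        complex.Im (w z) * complex.Im (phi z))).
      by apply: measurable_funB; exact: measurable_funM.
    by apply/funext => z; case: (w z) (phi z) => [? ?] [? ?].
  exact: normc_ge_absRe.
have iI w : L2loc Omega w ->
    mu.-integrable Omega (EFin \o (fun z => complex.Im (w z * phi z))).
  move=> Lw; have [mR mI _] := Lw; apply: (integrable_mul_test Lw tphi) => [|z].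
    rewrite (_ : (fun z => _) = (fun z => complex.Re (w z) * complex.Im (phi z) +
        complex.Im (w z) * complex.Re (phi z))).
      by apply: measurable_funD; exact: measurable_funM.
    by apply/funext => z; case: (w z) (phi z) => [? ?] [? ?].
  exact: normc_ge_absIm.
apply/eqP; rewrite eq_complex /cintegral /=; apply/andP; split; apply/eqP.
  rewrite -(RintegralB mO (iR _ Lu) (iR _ Lv)).
  by apply: eq_Rintegral => z _; rewrite mulrBl raddfB.
rewrite -(RintegralB mO (iI _ Lu) (iI _ Lv)).
by apply: eq_Rintegral => z _; rewrite mulrBl raddfB.
Qed.

Lemma test_functionS W W' phi : W `<=` W' -> test_function W phi ->
  test_function W' phi.
Proof. by move=> WW' [sp cp Wp]; split => //; exact: subset_trans WW'. Qed.

Lemma distributionB W K L : Defs.distribution W K -> Defs.distribution W L ->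
  Defs.distribution W (fun phi => K phi - L phi :> R[i]).
Proof.
move=> [linK bK] [linL bL]; split.
  by move=> a phi psi tphi tpsi; rewrite linK // linL //; ring.
move=> S cS SW; have [C [N CN]] := bK S cS SW; have [C' [N' CN']] := bL S cS SW.
exists (C + C'), (maxn N N') => phi M tphi sphi leM.
apply: le_trans (normcB_le _ _) _; rewrite mulrDl lerD //.
  by apply: CN => // s x sN; apply: leM; rewrite (leq_trans sN) // leq_maxl.
by apply: CN' => // s x sN; apply: leM; rewrite (leq_trans sN) // leq_maxr.
Qed.

(** At a point outside both supports each distribution vanishes on test functions near the point, so
    both do on the intersection of the two neighbourhoods. *)
Lemma distribution_suppB W K L :
  distribution_supp W (fun phi => K phi - L phi :> R[i]) `<=`
  distribution_supp W K `|` distribution_supp W L.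
Proof.
move=> p [Wp pKL]; apply: contrapT => /not_orP[pK pL].
have vanish (Q : ('rV[R]_m -> R[i]) -> R[i]) : ~ distribution_supp W Q p ->
    exists V, [/\ open V, V p &
      forall phi, test_function (W `&` V) phi -> Q phi = 0].
  move=> /not_andP[//|/existsNP[V /not_implyP[oV /not_implyP[Vp nV]]]].
  exists V; split => // phi tphi; apply: contrapT => /eqP Qphi.
  by apply: nV; exists phi.
have [V [oV Vp KV]] := vanish K pK; have [V' [oV' V'p LV']] := vanish L pL.
have [phi [tphi]] := pKL (V `&` V') (openI oV oV') (conj Vp V'p).
rewrite KV ?LV' ?subrr ?eqxx //; apply: test_functionS tphi.
- by move=> z [? []].
- by move=> z [? []].
Qed.

End test_functions.

Section complex_families.
Context {R : realType} {n : nat}.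
Variables (Omega : set (Cn R n)) (Phi : Cn R n -> R).
Hypothesis oOmega : open Omega.
Implicit Types A B : operator_family R n.

Lemma is_kernelB A B h K L :
  (forall u, Defs.L2loc Omega u -> Defs.L2loc Omega (A h u)) ->
  (forall u, Defs.L2loc Omega u -> Defs.L2loc Omega (B h u)) ->
  is_kernel Omega (A h) K -> is_kernel Omega (B h) L ->
  is_kernel Omega (sub_family A B h) (fun phi => K phi - L phi).
Proof.
move=> pA pB [dK kK] [dL kL]; split; first exact: distributionB.
move=> phi psi tphi tpsi; rewrite kK // kL //.
by rewrite -cintegralB_test //; [apply: pA|apply: pB]; exact: test_function_L2loc.
Qed.

(** The difference of the kernels is a kernel of the difference, and its support lies in the union
    of the supports. *)
Lemma properly_supportedB A B : L2loc_family Omega A -> L2loc_family Omega B ->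
  uniformly_properly_supported Omega A -> uniformly_properly_supported Omega B ->
  uniformly_properly_supported Omega (sub_family A B).
Proof.
move=> fA fB [h1 [/andP[h10 h11] [K [kK K1 K2]]]] [h2 [/andP[h20 h21] [L [kL L1 L2]]]].
have split_h h : 0 < h <= Num.min h1 h2 -> 0 < h <= h1 /\ 0 < h <= h2.
  by rewrite le_min => /and3P[-> -> ->].
exists (Num.min h1 h2); split; first by rewrite lt_min h10 h20 ge_min h11.
exists (fun h phi => K h phi - L h phi); split.
- move=> h /split_h[hh1 hh2]; have hh : 0 < h <= 1.
    by move: hh1 => /andP[-> /le_trans]; exact.
  apply: is_kernelB; [by case: (fA h hh)|by case: (fB h hh)|exact: kK|exact: kL].
- move=> D2 cD2; have [D1 [cD1 KD]] := K1 D2 cD2; have [E1 [cE1 LD]] := L1 D2 cD2.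
  exists (D1 `|` E1); split; first exact: rel_compactU.
  move=> h /split_h[hh1 hh2] y [x [D2x /distribution_suppB[Kxy|Lxy]]].
    by left; apply: (KD h hh1); exists x.
  by right; apply: (LD h hh2); exists x.
- move=> D1 cD1; have [D2 [cD2 KD]] := K2 D1 cD1; have [E2 [cE2 LD]] := L2 D1 cD1.
  exists (D2 `|` E2); split; first exact: rel_compactU.
  move=> h /split_h[hh1 hh2] x [y [D1y /distribution_suppB[Kxy|Lxy]]].
    by left; apply: (KD h hh1); exists y.
  by right; apply: (LD h hh2); exists y.
Qed.

End complex_families.

(** * Comparison of two projections *)

Section asymptotics.
Context {R : realType} {n : nat}.
Variables (Omega : set (Cn R n)) (Phi : Cn R n -> R).
Hypothesis oOmega : open Omega.
Hypothesis cPhi : {within Omega, continuous Phi}.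
Implicit Types A B : operator_family R n.

Local Notation L2space Psi := (L2_Phi_loc Omega Psi).
Local Notation Hspace Psi := (H_Phi_loc Omega Phi Psi).

Lemma le_range (h h0 h1 : R) : h0 <= h1 -> 0 < h <= h0 -> 0 < h <= h1.
Proof. by move=> h01 /andP[-> hh0]; rewrite (le_trans hh0). Qed.

(** Each O(1) statement comes with its own threshold; this and the next lemmas allow a common
    smaller one. *)
Lemma decayW h0 h1 s D A : h0 <= h1 ->
  decay Omega Phi h1 s D A -> decay Omega Phi h0 s D A.
Proof.
move=> h01 [E [C [gE C0 EC]]]; exists E, C; split => // h u hh.
by apply: EC; exact: le_range hh.
Qed.

Lemma exp_smallW h0 h1 A : h0 <= h1 ->
  exp_small Omega Phi h1 A -> exp_small Omega Phi h0 A.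
Proof.
by move=> h01 eA D /eA[s s0 dA]; exists s => //; exact: decayW dA.
Qed.

Lemma bounded_familyW h0 h1 A : h0 <= h1 ->
  bounded_family Omega Phi h1 A -> bounded_family Omega Phi h0 A.
Proof. by move=> h01 bA D /bA; exact: decayW. Qed.

Lemma adjoint_familiesW h0 h1 A B : h0 <= h1 ->
  adjoint_families Omega Phi h1 A B -> adjoint_families Omega Phi h0 A B.
Proof. by move=> h01 AB h D E u v hh; apply: AB; exact: le_range hh. Qed.

Lemma adjoint_families_sym h0 A B :
  adjoint_families Omega Phi h0 A B -> adjoint_families Omega Phi h0 B A.
Proof.
move=> AB h D E u v hh gD gE Lu Lv.
by rewrite weighted_dotC -AB // weighted_dotC.
Qed.

Lemma L2normE (Psi : Cn R n -> R) h D u :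
  L2norm Psi h D u = (weighted_norm2 Psi h D u `^ 2^-1)%E.
Proof. by []. Qed.

(** It serves with [Y] a space H_{Phi,Phi1}: boundedness sends one projection into it, and the
    reproducing property of the other starts from it. *)
Lemma bigO1_comp X Y Z A B : bigO1 Omega X Y B -> bigO1 Omega Y Z A ->
  bigO1 Omega X Z (comp_family A B).
Proof.
move=> [h1 [/andP[h10 h11] memB bB]] [h2 [/andP[h20 h21] memA bA]].
have m1 : Num.min h1 h2 <= h1 by rewrite ge_min lexx.
have m2 : Num.min h1 h2 <= h2 by rewrite ge_min lexx orbT.
exists (Num.min h1 h2); split.
- by rewrite lt_min h10 h20 (le_trans m1).
- move=> h u hh Xu; apply: memA; first exact: le_range hh.
  by apply: memB => //; exact: le_range hh.
- move=> D mD cD; have [E [C [mE cE C0 CE]]] := bA D mD cD.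
  have [F [C' [mF cF C'0 CF]]] := bB E mE cE.
  exists F, (C * C'); split => //; first exact: mulr_gt0.
  move=> h u hh Xu; have hh1 := le_range m1 hh; have hh2 := le_range m2 hh.
  apply: le_trans (CE h _ hh2 (memB h u hh1 Xu)) _.
  rewrite EFinM -muleA; apply: lee_wpmul2l; first by rewrite lee_fin ltW.
  exact: CF.
Qed.

(** On each good set [Psi] lies below [Phi] by some s > 0, and this gap becomes the gain exp(- s /
    h). *)
Lemma bigO1_exp_small Psi A : continuous_below Omega Phi Psi ->
  bigO1 Omega (L2space Phi) (L2space Psi) A ->
  exists2 h0, 0 < h0 <= 1 & exp_small Omega Phi h0 A.
Proof.
move=> [cPsi PsiPhi] [h0 [h00 memA bA]]; exists h0 => // D gD.
have [s s0 gap] := good_gap gD cPsi cPhi PsiPhi.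
have [E [C [mE cE C0 EC]]] := bA D gD.1 gD.2.
exists s => //; exists E, (C ^+ 2); split => //; first exact: exprn_gt0.
move=> h u hh Lu; have LA := memA h u hh Lu; have /andP[hp _] := hh.
apply: le_trans (weighted_norm2_shift oOmega cPhi cPsi gD LA hp gap) _.
rewrite [C ^+ 2 * _]mulrC EFinM -muleA; apply: lee_wpmul2l; first by rewrite lee_fin expR_ge0.
rewrite -poweR_half_le ?weighted_norm2_ge0 ?(ltW C0) //.
exact: (EC h u hh Lu).
Qed.

(** The part of the H-seminorm that involves dbar is nonnegative and is dropped. *)
Lemma bigO1_bounded Psi A : bigO1 Omega (L2space Phi) (Hspace Psi) A ->
  exists2 h0, 0 < h0 <= 1 & bounded_family Omega Phi h0 A.
Proof.
move=> [h0 [h00 memA bA]]; exists h0 => // D gD.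
have [E [C [mE cE C0 EC]]] := bA D gD.1 gD.2.
exists E, (C ^+ 2); split => //; first exact: exprn_gt0.
move=> h u hh Lu; rewrite mulr0 mul0r expR0 mulr1.
rewrite -poweR_half_le ?weighted_norm2_ge0 ?(ltW C0) //.
apply: le_trans (EC h u hh Lu); rewrite leeDl //; exact: poweR_ge0.
Qed.

(** Take real parts of the adjoint relation for the truncated functions; the truncations reduce the
    integrals over [Omega] to integrals over [E] and [D]. *)
Lemma formal_adjoint_families A B : L2loc_family Omega A ->
  L2loc_family Omega B -> formal_adjoint Omega Phi A B ->
  exists2 h0, 0 < h0 <= 1 & adjoint_families Omega Phi h0 A B.
Proof.
move=> fA fB [h0 [h00 AB]]; exists h0 => // h D E u v hh gD gE Lu Lv.
have LDu := L2loc_cut oOmega (good_measurable gD) Lu.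
have LEv := L2loc_cut oOmega (good_measurable gE) Lv.
have Re_inner w1 w2 :
    complex.Re (inner_Phi Omega Phi h w1 w2) = weighted_dot Phi h Omega w1 w2.
  apply: eq_Rintegral => z _; rewrite /re_dot /weight.
  by case: (w1 z) (w2 z) => [a b] [c d] /=; ring.
have := congr1 (@complex.Re R) (AB h _ _ hh LDu (compactly_supported_cut u gD)
  LEv (compactly_supported_cut v gE)).
rewrite !Re_inner weighted_dotC (weighted_dot_cutl _ _ _ _ (good_sub gE)).
by rewrite (weighted_dot_cutl _ _ _ _ (good_sub gD)) weighted_dotC.
Qed.

(** The converse of [bigO1_exp_small]: the single function [lower_weight] works on all good sets at
    once. *)
Lemma exp_small_bigO1 h0 A : 0 < h0 <= 1 -> preserves_L2loc Omega h0 A ->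
  exp_small Omega Phi h0 A ->
  exists Psi, continuous_below Omega Phi Psi /\
    bigO1 Omega (L2space Phi) (L2space Psi) A.
Proof.
move=> h00 pA eA; exists (lower_weight Omega Phi h0 A); split.
  split; [exact: continuous_lower_weight|move=> z; exact: lower_weight_lt].
exists h0; split => // D mD cD.
have [E [C [gE C0 EC]]] :=
  exp_small_lower_bounded oOmega cPhi pA eA (conj mD cD : good Omega D).
exists E, (Num.sqrt C); split; [exact: gE.1|exact: gE.2|by rewrite sqrtr_gt0|].
move=> h u hh Lu; rewrite /= !L2normE poweR_half_le ?weighted_norm2_ge0 ?sqrtr_ge0 //.
by rewrite sqr_sqrtr ?(ltW C0) //; exact: EC.
Qed.

End asymptotics.

(** * Algebra of two approximate projections and their adjoints *)

Section projection_difference.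
Context {R : realType} {m : nat}.
Variables (Omega : set 'rV[R]_m) (Phi : 'rV[R]_m -> R) (h0 : R).
Hypothesis oOmega : open Omega.
Hypothesis cPhi : {within Omega, continuous Phi}.
Variables A As P Ps : R -> ('rV[R]_m -> R[i]) -> 'rV[R]_m -> R[i].

Local Notation preserves_L2loc := (preserves_L2loc Omega h0).
Local Notation linear_family := (linear_family Omega h0).
Local Notation bounded_family := (bounded_family Omega Phi h0).
Local Notation exp_small := (exp_small Omega Phi h0).
Local Notation adjoint_families := (adjoint_families Omega Phi h0).

Lemma exp_small_projection_diff :
  preserves_L2loc A -> preserves_L2loc As ->
  preserves_L2loc P -> preserves_L2loc Ps ->
  linear_family As -> linear_family P -> linear_family Ps ->
  bounded_family A -> bounded_family P ->
  adjoint_families As A -> adjoint_families Ps P ->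
  exp_small (diff_family A As) -> exp_small (diff_family P Ps) ->
  exp_small (diff_family (comp_family A P) P) ->
  exp_small (diff_family (comp_family P A) A) ->
  exp_small (diff_family P A).
Proof.
move=> pA pAs pP pPs lAs lP lPs bA bP jA jP eN0 eN1 eAP ePA.
have pN0 := preserves_diff oOmega pA pAs; have pN1 := preserves_diff oOmega pP pPs.
have bN0 := exp_small_bounded eN0; have bN1 := exp_small_bounded eN1.
(* The adjoint is the family minus their bounded difference, hence bounded too. *)
have bounded_adjoint B Bs : preserves_L2loc B -> preserves_L2loc (diff_family B Bs) ->
    bounded_family B -> bounded_family (diff_family B Bs) -> bounded_family Bs.
  move=> pB pD bB bD; rewrite (_ : Bs = diff_family B (diff_family B Bs)).
    exact: bounded_diff.
  by apply/funext => h; apply/funext => u; apply/funext => z; rewrite /diff_family subKr.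
have bAs := bounded_adjoint _ _ pA pN0 bA bN0.
have bPs := bounded_adjoint _ _ pP pN1 bP bN1.
have pT := preserves_comp pAs pPs; have pPA := preserves_comp pP pA.
have pAP := preserves_comp pA pP.
have lcAs := bounded_local oOmega cPhi pAs lAs bAs.
have lcPs := bounded_local oOmega cPhi pPs lPs bPs.
(* This is the adjoint of [P] [A] - [A], so it inherits smallness by duality. *)
have eT : exp_small (diff_family (comp_family As Ps) As).
  have lcT := local_diff (local_comp pPs lcAs lcPs) lcAs.
  apply: (adjoint_exp_small oOmega cPhi _ _ lcT _ ePA); try exact: preserves_diff.
  apply: adjoint_diff => //; exact: adjoint_comp.
have eN0P := exp_small_compl pP eN0 bP.
have eAsN1 := exp_small_compr pN1 bAs eN1.
have pN0P := preserves_comp pN0 pP; have pAsN1 := preserves_comp pAs pN1.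
have pE := preserves_diff oOmega pAP pP.
have pTs := preserves_diff oOmega pT pAs.
(* The four-term identity grouped into differences only: (As (P - Ps) - ((A - As) - (A - As) P)) -
   ((A P - P) - (As Ps - As)). *)
apply: (@exp_small_ae _ _ _ _ _ oOmega cPhi _
  (diff_family (diff_family (comp_family As (diff_family P Ps))
    (diff_family (diff_family A As) (comp_family (diff_family A As) P)))
  (diff_family (diff_family (comp_family A P) P)
    (diff_family (comp_family As Ps) As)))).
- exact: preserves_diff.
- by do 3?apply: preserves_diff => //.
(* Linearity of [As] on P u - Ps u is what makes the identity hold almost everywhere; the rest is
   pointwise algebra. *)
- move=> h u hh Lu; have := lAs h (-1) _ _ hh (pPs h u hh Lu) (pP h u hh Lu).
  rewrite (_ : (fun x => _) = diff_family P Ps h u); last first.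
    by apply/funext => z; rewrite /diff_family mulN1r addrC.
  apply: filterS => z /= lin Oz; rewrite /diff_family /comp_family.
  by rewrite -/(diff_family P Ps h u) lin //; ring.
- have pN0P' := preserves_diff oOmega pN0 pN0P.
  have eN0P' := exp_small_diff oOmega cPhi pN0 pN0P eN0 eN0P.
  apply: (exp_small_diff oOmega cPhi).
  + exact: preserves_diff.
  + exact: preserves_diff.
  + exact: (exp_small_diff oOmega cPhi pAsN1 pN0P' eAsN1 eN0P').
  + exact: (exp_small_diff oOmega cPhi pE pTs eAP eT).
Qed.

End projection_difference.

Theorem proposition4p15 (R : realType) (n : nat) (Omega : set (Cn R n))
    (Phi : Cn R n -> R) (Pi0 Pi1 : operator_family R n) :
  open Omega ->
  real_analytic_on Omega Phi ->
  strictly_psh Omega Phi ->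
  L2loc_family Omega Pi0 ->
  L2loc_family Omega Pi1 ->
  asymptotic_projection Omega Phi Pi0 ->
  asymptotic_projection Omega Phi Pi1 ->
  equiv_Phi Omega Phi Pi1 Pi0.
Proof.
move=> oO _ [/(_ [::] isT)[cPhi _] _] fA fP.
move=> [[PhiA [cA bA]] kA [As [fAs adA [_ [PsiA [cPsiA oA]]]]] rA].
move=> [[PhiP [cP bP]] kP [Ps [fPs adP [_ [PsiP [cPsiP oP]]]]] rP].
rewrite /= in cPhi.
split; first exact: properly_supportedB.
(* Each reproducing property is used with the weight that controls dbar on the range of the other
   operator. *)
have [PsiAP [cAP rAP]] := rA _ cP; have [PsiPA [cPA rPA]] := rP _ cA.
have [a1 /andP[a10 a11] bA'] := bigO1_bounded bA.
have [a2 /andP[a20 _] bP'] := bigO1_bounded bP.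
have [a3 /andP[a30 _] eN0] := bigO1_exp_small oO cPhi cPsiA oA.
have [a4 /andP[a40 _] eN1] := bigO1_exp_small oO cPhi cPsiP oP.
(* The composition of [Pi0] - 1 with [Pi1] is, by unfolding, the difference of [comp_family Pi0 Pi1]
   and [Pi1]; the next line exchanges the roles. *)
have [a5 /andP[a50 _] eAP] := bigO1_exp_small oO cPhi cAP (bigO1_comp bP rAP).
have [a6 /andP[a60 _] ePA] := bigO1_exp_small oO cPhi cPA (bigO1_comp bA rPA).
have [a7 /andP[a70 _] jA] := formal_adjoint_families oO fA fAs adA.
have [a8 /andP[a80 _] jP] := formal_adjoint_families oO fP fPs adP.
(* A common threshold for the eight estimates. *)
pose h0 := \big[Num.min/1]_(a <- [:: a1; a2; a3; a4; a5; a6; a7; a8]) a.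
have h0a a : a \in [:: a1; a2; a3; a4; a5; a6; a7; a8] -> h0 <= a.
  by move=> ain; apply: bigmin_inf_seq ain _ _.
have h00 : 0 < h0.
  by rewrite /h0 !big_cons big_nil !lt_min a10 a20 a30 a40 a50 a60 a70 a80 ltr01.
have h01 : h0 <= 1 by apply: le_trans a11; apply: h0a; rewrite inE eqxx.
have fam B : L2loc_family Omega B ->
    preserves_L2loc Omega h0 B /\ linear_family Omega h0 B.
  by move=> fB; split=> h; [move=> u|move=> a u v];
    move=> /(le_range h01)/fB[LB _ lB]; [exact: LB|exact: lB].
have [pA lA] := fam _ fA; have [pP lP] := fam _ fP.
have [pAs lAs] := fam _ fAs; have [pPs lPs] := fam _ fPs.
have h0E : 0 < h0 <= 1 by rewrite h00.
apply: (exp_small_bigO1 oO cPhi h0E); first exact: preserves_diff.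
apply: (exp_small_projection_diff oO cPhi pA pAs pP pPs lAs lP lPs).
- by apply: bounded_familyW bA'; apply: h0a; rewrite !inE eqxx ?orbT.
- by apply: bounded_familyW bP'; apply: h0a; rewrite !inE eqxx ?orbT.
- apply: adjoint_families_sym; apply: adjoint_familiesW jA.
  by apply: h0a; rewrite !inE eqxx ?orbT.
- apply: adjoint_families_sym; apply: adjoint_familiesW jP.
  by apply: h0a; rewrite !inE eqxx ?orbT.
- by apply: exp_smallW eN0; apply: h0a; rewrite !inE eqxx ?orbT.
- by apply: exp_smallW eN1; apply: h0a; rewrite !inE eqxx ?orbT.
- by apply: exp_smallW eAP; apply: h0a; rewrite !inE eqxx ?orbT.
- by apply: exp_smallW ePA; apply: h0a; rewrite !inE eqxx ?orbT.
Qed.
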